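(* For all integers $n\geq 1$: $\overline{pl}_4(12n)\equiv 0\pmod 8$, $\overline{pl}_4(6n+3)\equiv 0\pmod 8$, $\overline{pl}_8(210n)\equiv 0\pmod 8$, $\overline{pl}_8(210n+3)\equiv 0\pmod 8$, $\overline{pl}_8(210n+9)\equiv 0\pmod 8$, and $\overline{pl}_8(210n+105)\equiv 0\pmod 8$.
   Context: A plane overpartition of $n$ is a plane partition of $n$ (an array $(\pi_{ij})_{i,j\geq1}$ of nonnegative integers, weakly decreasing along rows and down columns, with $\sum\pi_{ij}=n$) in which entries may be overlined subject to: in each row, the last occurrence of an integer may be overlined or not and all other occurrences of that integer in the row are not overlined; in each column, the first occurrence of an integer may be overlined or not and all other occurrences of that integer in the column are overlined. A $k$-rowed plane overpartition is a plane overpartition with at most $k$ (nonzero) rows; $\overline{pl}_k(n)$ is their number ($\overline{pl}_k(0)=1$), with generating function $\sum_{n\geq0}\overline{pl}_k(n)q^n=\prod_{n\geq1}\left(\frac{1+q^n}{1-q^n}\right)^{\min\{k,n\}}$. *)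

(* Defs.v *)
From mathcomp Require Import all_boot.

Set Implicit Arguments.
Unset Strict Implicit.
Unset Printing Implicit Defensive.

(* An array (pi_ij) of nonnegative integers together with overline marks.
   If pi_ij > 0 (indices from 0) in a plane partition of n, then the i + j + 1
   entries pi_{0,0}, ..., pi_{i,0} and pi_{0,1}, ..., pi_{0,j} are positive, so
   i, j < n, and every entry is at most n.  Hence an infinite array that is a
   plane partition of n is the same thing as its n x n corner with entries in
   {0, ..., n}; for n = 0 the corner is empty and there is exactly one array. *)
Definition overarray (n : nat) := {ffun 'I_n * 'I_n -> 'I_n.+1 * bool}.

Definition entry (n : nat) (a : overarray n) (i j : 'I_n) : nat := (a (i, j)).1.

Definition overlined (n : nat) (a : overarray n) (i j : 'I_n) : bool :=
  (a (i, j)).2.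

Definition plane_partition (n : nat) (a : overarray n) : bool :=
  [&& [forall i : 'I_n, forall j : 'I_n, forall j' : 'I_n,
         (j <= j') ==> (entry a i j' <= entry a i j)],
      [forall i : 'I_n, forall i' : 'I_n, forall j : 'I_n,
         (i <= i') ==> (entry a i' j <= entry a i j)]
    & \sum_(i < n) \sum_(j < n) entry a i j == n].

(* Only positive entries are parts: zeros carry no overline and are exempt from
   the column rule. *)
Definition overline_support (n : nat) (a : overarray n) : bool :=
  [forall i : 'I_n, forall j : 'I_n, overlined a i j ==> (0 < entry a i j)].

(* An entry that is not the last occurrence of its value in its row is not
   overlined; the last occurrence is unconstrained by its row. *)
Definition overline_rows (n : nat) (a : overarray n) : bool :=
  [forall i : 'I_n, forall j : 'I_n, forall j' : 'I_n,
     [&& 0 < entry a i j, j < j' & entry a i j' == entry a i j]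
       ==> ~~ overlined a i j].

(* An entry that is not the first occurrence of its value in its column is
   overlined; the first occurrence is unconstrained by its column. *)
Definition overline_cols (n : nat) (a : overarray n) : bool :=
  [forall i : 'I_n, forall i' : 'I_n, forall j : 'I_n,
     [&& 0 < entry a i' j, i < i' & entry a i j == entry a i' j]
       ==> overlined a i' j].

Definition plane_overpartition (n : nat) (a : overarray n) : bool :=
  [&& plane_partition a, overline_support a, overline_rows a
    & overline_cols a].

(* Columns decrease, so the nonzero rows are the topmost ones and having at
   most k of them means that the rows of index >= k (from 0) vanish. *)
Definition at_most_rows (k n : nat) (a : overarray n) : bool :=
  [forall i : 'I_n, forall j : 'I_n, (k <= i) ==> (entry a i j == 0)].

Definition pl_over (k n : nat) : nat :=
  #|[set a : overarray n | plane_overpartition a && at_most_rows k a]|.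

(* Main.v *)
(** Fix the underlying plane partition.  A positive entry that is followed in its
    row by an equal entry must be plain, one that lies below an equal entry must
    be overlined, an entry subject to both rules makes overlining impossible, and
    the remaining entries are free.  Hence [pl_over k n] is the sum of
    [2 ^ (number of free cells)] over the plane partitions of [n] with at most
    [k] rows and no conflicting cell.  Every value that occurs has a free cell, so
    modulo 8 only two families matter: one free cell (a single value [m] filling
    a hook) and two free cells (a value [m1] filling a hook of size [s1],
    surrounded by a smaller value [m2] filling a connected border strip of size
    [s2], with [m1 * s1 + m2 * s2 = n]).

    For [k = 4, 8] the number of hook-strip pairs of sizes [(s1, s2)] has an
    explicit parity, symmetric in [s1] and [s2]: up to finitely many sizes below
    [k] it is odd exactly when [|s1 - s2|] is odd and smaller than [k].  With
    [G (x, y)] the number of solutions of [a x + b y = n], [a, b > 0], the sums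
    over [r] of [G (r, r + d)] telescope thanks to
    [G (d, r) = G (r, r + d) + [r + d | n] + G (d, r + d)].
    What remains modulo 8 is a combination of [G (x, y)] and divisibility
    conditions with [x, y < k], which is periodic in [n], of period 24 when
    [k = 4] and 840 when [k = 8]; finitely many residues are then evaluated. *)

Require Import Defs.
From mathcomp Require Import all_boot.
From mathcomp Require Import zify.

Set Implicit Arguments.
Unset Strict Implicit.
Unset Printing Implicit Defensive.

(** * Free cells *)

(** Testing the adjacent cell suffices in a decreasing array: an equal entry further right, or
    further up, forces everything in between to be equal. *)
Definition nonlast (f : nat -> nat -> nat) (i j : nat) : bool :=
  (0 < f i j) && (f i j.+1 == f i j).

Definition nonfirst (f : nat -> nat -> nat) (i j : nat) : bool :=
  [&& 0 < f i j, 0 < i & f i.-1 j == f i j].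

Definition free_cell (f : nat -> nat -> nat) (i j : nat) : bool :=
  [&& 0 < f i j, ~~ nonlast f i j & ~~ nonfirst f i j].

Definition clash_cell (f : nat -> nat -> nat) (i j : nat) : bool :=
  nonlast f i j && nonfirst f i j.

(** Extension by zero to all indices, so that neighbours can be taken without range conditions. *)
Definition get (n : nat) (e : {ffun 'I_n * 'I_n -> 'I_n.+1}) (i j : nat) : nat :=
  if insub i is Some i' then if insub j is Some j' then e (i', j') : nat else 0
  else 0.

Lemma getE n (e : {ffun 'I_n * 'I_n -> 'I_n.+1}) (i j : 'I_n) :
  get e i j = e (i, j).
Proof. by rewrite /get !valK. Qed.

Lemma get_out_row n (e : {ffun 'I_n * 'I_n -> 'I_n.+1}) i j :
  n <= i -> get e i j = 0.
Proof. by move=> h; rewrite /get insubN // -leqNgt. Qed.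

Lemma get_out_col n (e : {ffun 'I_n * 'I_n -> 'I_n.+1}) i j :
  n <= j -> get e i j = 0.
Proof. by move=> h; rewrite /get (@insubN _ _ _ j) -?leqNgt //; case: insub. Qed.

Definition pack n
  (eo : {ffun 'I_n * 'I_n -> 'I_n.+1} * {ffun 'I_n * 'I_n -> bool}) :
  overarray n := [ffun c => (eo.1 c, eo.2 c)].

Lemma entry_pack n e o i j : entry (@pack n (e, o)) i j = e (i, j).
Proof. by rewrite /entry ffunE. Qed.

Lemma overlined_pack n e o i j : overlined (@pack n (e, o)) i j = o (i, j).
Proof. by rewrite /overlined ffunE. Qed.

Lemma pack_inj n : injective (@pack n).
Proof.
move=> [e o] [e' o'] /ffunP h; congr (_, _); apply/ffunP => c;
  by have := h c; rewrite !ffunE /= => -[].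
Qed.

Definition underlying_ok (k n : nat) (e : {ffun 'I_n * 'I_n -> 'I_n.+1}) : bool :=
  plane_partition (pack (e, [ffun=> false])) &&
  at_most_rows k (pack (e, [ffun=> false])).

Lemma underlying_ok_pack k n e o :
  plane_partition (@pack n (e, o)) && at_most_rows k (pack (e, o))
  = underlying_ok k e.
Proof.
rewrite /underlying_ok; congr (_ && _).
  rewrite /plane_partition; congr [&& _, _ & _].
  - apply: eq_forallb => i; apply: eq_forallb => j; apply: eq_forallb => j'.
    by rewrite !entry_pack.
  - apply: eq_forallb => i; apply: eq_forallb => j; apply: eq_forallb => j'.
    by rewrite !entry_pack.
  - congr (_ == _); apply: eq_bigr => i _; apply: eq_bigr => j _.
    by rewrite !entry_pack.
apply: eq_forallb => i; apply: eq_forallb => j; by rewrite !entry_pack.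
Qed.

Definition decreasing_array (f : nat -> nat -> nat) : Prop :=
  forall i j, f i j.+1 <= f i j /\ f i.+1 j <= f i j.

Lemma decr_row f i j j' : decreasing_array f -> j <= j' -> f i j' <= f i j.
Proof.
move=> hf /subnK <-; elim: (j' - j) => // d IH.
by rewrite addSn (leq_trans (proj1 (hf _ _))).
Qed.

Lemma decr_col f i i' j : decreasing_array f -> i <= i' -> f i' j <= f i j.
Proof.
move=> hf /subnK <-; elim: (i' - i) => // d IH.
by rewrite addSn (leq_trans (proj2 (hf _ _))).
Qed.

Lemma underlying_okP k n (e : {ffun 'I_n * 'I_n -> 'I_n.+1}) :
  reflect [/\ decreasing_array (get e), forall i j, k <= i -> get e i j = 0
            & \sum_(i < n) \sum_(j < n) get e i j = n]
          (underlying_ok k e).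
Proof.
apply: (iffP andP) => [[/and3P[/'forall_'forall_forallP h1
   /'forall_'forall_forallP h2 /eqP h3] /'forall_forallP h4]|[h1 h2 h3]].
- have sE : \sum_(i < n) \sum_(j < n) get e i j = n.
    rewrite -[RHS]h3; apply: eq_bigr => i _; apply: eq_bigr => j _.
    by rewrite getE entry_pack.
  split=> //.
  + move=> i j; split.
      case: (ltnP j.+1 n) => hj; last by rewrite get_out_col.
      case: (ltnP i n) => hi; last by rewrite !get_out_row.
      have := implyP (h1 (Ordinal hi) (Ordinal (ltnW hj)) (Ordinal hj)) (leqnSn _).
      by rewrite !entry_pack -!getE.
    case: (ltnP i.+1 n) => hi; last by rewrite get_out_row.
    case: (ltnP j n) => hj; last by rewrite !get_out_col.
    have := implyP (h2 (Ordinal (ltnW hi)) (Ordinal hi) (Ordinal hj)) (leqnSn _).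
    by rewrite !entry_pack -!getE.
  + move=> i j hk.
    case: (ltnP i n) => hi; last by rewrite !get_out_row.
    case: (ltnP j n) => hj; last by rewrite !get_out_col.
    have := implyP (h4 (Ordinal hi) (Ordinal hj)) hk.
    by rewrite entry_pack -getE => /eqP.
- split.
    apply/and3P; split.
    + apply/'forall_'forall_forallP => i j j'; apply/implyP => h.
      by rewrite !entry_pack -!getE; apply: decr_row.
    + apply/'forall_'forall_forallP => i j j'; apply/implyP => h.
      by rewrite !entry_pack -!getE; apply: decr_col.
    + rewrite -[X in _ == X]h3; apply/eqP.
      apply: eq_bigr => i _; apply: eq_bigr => j _.
      by rewrite getE entry_pack.
  apply/'forall_forallP => i j; apply/implyP => h.
  by rewrite !entry_pack -!getE h2.
Qed.

Definition overline_choices n (e : {ffun 'I_n * 'I_n -> 'I_n.+1})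
  (c : 'I_n * 'I_n) : pred bool :=
  fun b => [&& b ==> (0 < get e c.1 c.2), nonlast (get e) c.1 c.2 ==> ~~ b
             & nonfirst (get e) c.1 c.2 ==> b].

(** Once the entries are fixed, the overlining rules bear on each cell separately, so the admissible
    markings form a dependent product. *)
Lemma plane_overpartition_pack k n e o :
  plane_overpartition (@pack n (e, o)) && at_most_rows k (pack (e, o))
  = underlying_ok k e && (o \in family (overline_choices e)).
Proof.
rewrite -(underlying_ok_pack k e o) /plane_overpartition.
case hp: (plane_partition _); last by [].
case hk: (at_most_rows _ _); rewrite ?andbF ?andbT //=.
have /underlying_okP[hd _ _] : underlying_ok k e.
  by rewrite -(underlying_ok_pack k e o) hp hk.
apply/and3P/familyP => [[/'forall_forallP h1 /'forall_'forall_forallP h2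
   /'forall_'forall_forallP h3] [i j]|h].
- rewrite /overline_choices -topredE /= getE.
  apply/and3P; split.
  + by have := h1 i j; rewrite overlined_pack entry_pack.
  + apply/implyP => /andP[p0 /eqP E].
    have hj : j.+1 < n.
      by case: (ltnP j.+1 n) => // hj; move: p0; rewrite -E get_out_col.
    have := h2 i j (Ordinal hj).
    by rewrite overlined_pack !entry_pack -!getE p0 /= leqnn E eqxx.
  + apply/implyP => /and3P[p0 i0 /eqP E].
    have hi : i.-1 < n by rewrite (leq_ltn_trans (leq_pred _)).
    have := h3 (Ordinal hi) i j.
    by rewrite overlined_pack !entry_pack -!getE p0 /= E eqxx prednK // leqnn.
- split.
  + apply/'forall_forallP => i j; rewrite overlined_pack entry_pack -getE.
    by have := h (i, j) => /and3P[].
  + apply/'forall_'forall_forallP => i j j'; apply/implyP => /and3P[].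
    rewrite overlined_pack !entry_pack -!getE => p0 lt /eqP E.
    have /and3P[_ /implyP h' _] := h (i, j); apply: h'.
    rewrite /nonlast p0 eqn_leq (proj1 (hd _ _)) /= -E.
    exact: (decr_row i hd lt).
  + apply/'forall_'forall_forallP => i j j'; apply/implyP => /and3P[].
    rewrite overlined_pack !entry_pack -!getE => p0 lt /eqP E.
    have /and3P[_ _ /implyP h'] := h (j, j'); apply: h'.
    have j0 : 0 < j by rewrite (leq_ltn_trans _ lt).
    rewrite /nonfirst p0 j0 /= eqn_leq -{1}E (decr_col j' hd) /=; last lia.
    by apply: (decr_col j' hd); lia.
Qed.

Lemma pl_over_sum k n :
  pl_over k n = \sum_(e : {ffun 'I_n * 'I_n -> 'I_n.+1} | underlying_ok k e)
                  \prod_c #|overline_choices e c|.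
Proof.
have -> : pl_over k n = #|[set eo | underlying_ok k eo.1 &&
           (eo.2 \in family (@overline_choices n eo.1))]|.
  rewrite -(card_imset _ (@pack_inj n)) /pl_over; apply: eq_card => a.
  rewrite inE; apply/idP/imsetP => [h|[[e o]]].
    have E : a = pack ([ffun c => (a c).1], [ffun c => (a c).2]).
      by apply/ffunP => c; rewrite !ffunE /=; case: (a c).
    exists ([ffun c => (a c).1], [ffun c => (a c).2]) => //.
    by rewrite inE -plane_overpartition_pack -E.
  by rewrite inE => h ->; rewrite plane_overpartition_pack.
rewrite -sum1_card.
under eq_bigl => eo do rewrite inE.
rewrite -(pair_big_dep (fun e => underlying_ok k e)
  (fun e (o : {ffun _ -> bool}) => o \in family (overline_choices e))
  (fun _ _ => 1)) /=.
apply: eq_bigr => e _; rewrite sum1_card card_family.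
by rewrite foldrE big_map big_enum.
Qed.

Definition free_cells n (e : {ffun 'I_n * 'I_n -> 'I_n.+1}) : {set 'I_n * 'I_n} :=
  [set c : 'I_n * 'I_n | free_cell (get e) c.1 c.2].

Definition clash_free n (e : {ffun 'I_n * 'I_n -> 'I_n.+1}) : bool :=
  [forall c : 'I_n * 'I_n, ~~ clash_cell (get e) c.1 c.2].

Lemma card_overline_choices n (e : {ffun 'I_n * 'I_n -> 'I_n.+1}) c :
  #|overline_choices e c| =
  if clash_cell (get e) c.1 c.2 then 0 else
  if free_cell (get e) c.1 c.2 then 2 else 1.
Proof.
rewrite -sum1_card /index_enum big_mkcond /= big_bool /=.
rewrite -!topredE /= /overline_choices /clash_cell /free_cell /nonlast /nonfirst.
by case: (0 < _) (_ == _) (0 < _) (_ == _) => [] [] [] [].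
Qed.

Lemma prod_overline_choices n (e : {ffun 'I_n * 'I_n -> 'I_n.+1}) :
  \prod_c #|overline_choices e c| =
  if clash_free e then 2 ^ #|free_cells e| else 0.
Proof.
case hc: (clash_free e).
  have h := forallP hc.
  rewrite -sum1_card [in RHS]big_mkcond /= (big_morph _ (expnD 2) (expn0 2)) /=.
  apply: eq_bigr => c _.
  by rewrite card_overline_choices (negbTE (h c)) inE; case: free_cell.
move/negbT: hc; rewrite negb_forall => /existsP[c]; rewrite negbK => h.
by rewrite (bigD1 c) //= card_overline_choices h.
Qed.

(** The rightmost occurrence of the value in the topmost row containing it is free. *)
Lemma free_cell_of_value f N l c :
  decreasing_array f -> (forall i j, N <= j -> f i j = 0) -> 0 < f l c ->
  exists i j, free_cell f i j /\ f i j = f l c.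
Proof.
move=> hd hN; set v := f l c => v0.
pose P i := has (fun j => f i j == v) (iota 0 N).
have PE i j : f i j = v -> P i.
  move=> E; apply/hasP; exists j; last by rewrite E.
  rewrite mem_iota /= add0n ltnNge; apply/negP => h; have := hN i j h; lia.
have exP : exists i, P i by exists l; apply: (PE l c).
case: (ex_minnP exP) => i /hasP[j0 _ /eqP E0] imin.
have exQ : exists j, f i j == v by exists j0; rewrite E0.
have ubQ j : f i j == v -> j <= N.
  by move/eqP => E; rewrite leqNgt; apply/negP => /ltnW h; have := hN i j h; lia.
case: (ex_maxnP exQ ubQ) => j /eqP E jmax.
exists i, j; split=> //; rewrite /free_cell /nonlast /nonfirst E v0 /=.
apply/andP; split.
  by apply/negP => /jmax; rewrite ltnn.
apply/negP => /andP[i0 /eqP E']; have := imin _ (PE _ _ E'); lia.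
Qed.

Definition with_free_cells (k n r : nat) : {set {ffun 'I_n * 'I_n -> 'I_n.+1}} :=
  [set e | [&& underlying_ok k e, clash_free e & #|free_cells e| == r]].

Lemma free_cells_gt0 k n (e : {ffun 'I_n * 'I_n -> 'I_n.+1}) :
  0 < n -> underlying_ok k e -> 0 < #|free_cells e|.
Proof.
move=> n0 /underlying_okP[hd _ hs]; rewrite card_gt0; apply/set0Pn.
have [l [c vc]] : exists l : 'I_n, exists c : 'I_n, 0 < get e l c.
  case: (boolP [exists l : 'I_n, exists c : 'I_n, 0 < get e l c]).
    by move=> /'exists_existsP.
  rewrite negb_exists => /forallP h; move: n0; rewrite -[n in 0 < n]hs big1 // => l _.
  rewrite big1 // => c _; have := h l; rewrite negb_exists => /forallP/(_ c).
  by case: (get _ _ _).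
have hN i j : n <= j -> get e i j = 0 by exact: get_out_col.
have [i [j [fij Eij]]] := free_cell_of_value hd hN vc.
have ij0 : 0 < get e i j by rewrite Eij.
have hi : i < n by rewrite ltnNge; apply/negP => h; rewrite get_out_row in ij0.
have hj : j < n by rewrite ltnNge; apply/negP => h; rewrite get_out_col in ij0.
by exists (Ordinal hi, Ordinal hj); rewrite inE.
Qed.

(** A clash-free array with [r] free cells contributes [2 ^ r]; [n > 0] excludes [r = 0], and
    [r > 2] gives a multiple of 8. *)
Lemma pl_over_mod8 k n : 0 < n ->
  pl_over k n = 2 * #|with_free_cells k n 1| + 4 * #|with_free_cells k n 2| %[mod 8].
Proof.
move=> n0; rewrite pl_over_sum.
pose t (e : {ffun 'I_n * 'I_n -> 'I_n.+1}) :=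
  if clash_free e && (2 < #|free_cells e|) then 2 ^ (#|free_cells e| - 3) else 0.
have E e : underlying_ok k e -> \prod_c #|overline_choices e c| =
   2 * (clash_free e && (#|free_cells e| == 1)) +
   4 * (clash_free e && (#|free_cells e| == 2)) + 8 * t e.
  move=> ok; rewrite prod_overline_choices /t.
  have := free_cells_gt0 n0 ok.
  case: clash_free => //=; case: #|free_cells e| => [|[|[|m]]] //= _.
  by rewrite subSS subSS subSS subn0 !expnS; lia.
rewrite (eq_bigr _ E) 2!big_split /= -!big_distrr /= addnC mulnC modnMDl.
have cardE r : \sum_(e : {ffun 'I_n * 'I_n -> 'I_n.+1} | underlying_ok k e)
     (clash_free e && (#|free_cells e| == r))
   = #|with_free_cells k n r|.
  rewrite -sum1_card big_mkcond [RHS]big_mkcond /=; apply: eq_bigr => e _.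
  by rewrite inE; case: underlying_ok => //=; case: (clash_free e && _).
by rewrite !cardE.
Qed.

(** * Hooks and border strips *)

Definition tab n (f : nat -> nat -> nat) : {ffun 'I_n * 'I_n -> 'I_n.+1} :=
  [ffun c : 'I_n * 'I_n => inord (f c.1 c.2)].

(** The total [n] bounds every entry, so [inord] truncates nothing. *)
Lemma get_tab n f :
  (forall i j, n <= i \/ n <= j -> f i j = 0) ->
  \sum_(i < n) \sum_(j < n) f i j = n ->
  forall i j, get (tab n f) i j = f i j.
Proof.
move=> hout hs i j.
case: (ltnP i n) => hi; last by rewrite get_out_row // hout //; left.
case: (ltnP j n) => hj; last by rewrite get_out_col // hout //; right.
have := getE (tab n f) (Ordinal hi) (Ordinal hj); rewrite /= => ->.
rewrite ffunE /= inordK // ltnS -[X in _ <= X]hs.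
rewrite (bigD1 (Ordinal hi)) //= (bigD1 (Ordinal hj)) //=; lia.
Qed.

Lemma free_cell_ext f g i j : (forall i j, f i j = g i j) ->
  free_cell f i j = free_cell g i j.
Proof. by move=> h; rewrite /free_cell /nonlast /nonfirst !h. Qed.

Lemma clash_cell_ext f g i j : (forall i j, f i j = g i j) ->
  clash_cell f i j = clash_cell g i j.
Proof. by move=> h; rewrite /clash_cell /nonlast /nonfirst !h. Qed.

(** * Arrays with at most two values on nested shapes *)

Definition two_level (m1 m2 : nat) (la mu : nat -> nat) (l c : nat) : nat :=
  if c < la l then m1 else if c < mu l then m2 else 0.

Lemma two_level_decreasing m1 m2 la mu :
  m2 <= m1 -> (forall l, la l.+1 <= la l) -> (forall l, mu l.+1 <= mu l) ->
  decreasing_array (two_level m1 m2 la mu).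
Proof.
move=> hm hla hmu l c; rewrite /two_level; have := hla l; have := hmu l.
by split; do ![case: ifP]; lia.
Qed.

Section TwoLevel.
Variables (m1 m2 : nat) (la mu : nat -> nat).
Hypotheses (m1_gt0 : 0 < m1) (m2_lt : forall l, la l < mu l -> 0 < m2 < m1)
  (la_le : forall l, la l <= mu l).

(** A clash needs three equal cells: one, its right neighbour and its upper neighbour. For [m1] this
    contradicts width at most 1 below row 0; for [m2] it contradicts that a row overhangs the inner
    row above it by at most one cell. *)
Lemma two_level_clash l c :
  (forall l, la l.+1 <= 1 /\ mu l.+1 <= (la l).+1) ->
  ~~ clash_cell (two_level m1 m2 la mu) l c.
Proof.
move=> h; rewrite /clash_cell /nonlast /nonfirst /two_level.
case: l => [|l] /=; first by rewrite !andbF.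
have := h l; have := la_le l; have := la_le l.+1.
have := @m2_lt l; have := @m2_lt l.+1.
by do ![case: ifP]; lia.
Qed.

(** Below row 0 the end of an inner row lies under another [m1]. The end of a strip row is free
    exactly when the cell above it is outside the strip. *)
Lemma two_level_free l c :
  (forall l, la l.+1 <= la l) -> (forall l, mu l.+1 <= mu l) ->
  free_cell (two_level m1 m2 la mu) l c =
  ((l == 0) && (c.+1 == la 0)) ||
  (c.+1 == mu l) && ((la l < mu l) && ((l == 0) || (mu l <= la l.-1))).
Proof.
move=> hla hmu; rewrite /free_cell /nonlast /nonfirst /two_level.
case: l => [|l] /=.
  have := la_le 0; have := @m2_lt 0; do ![case: ifP]; lia.
have := hla l; have := hmu l; have := la_le l; have := la_le l.+1.
have := @m2_lt l; have := @m2_lt l.+1.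
by do ![case: ifP]; lia.
Qed.

End TwoLevel.

Lemma sum_ltn n w : \sum_(c < n) (c < w : nat) = minn w n.
Proof.
elim: n => [|n IH]; first by rewrite big_ord0; lia.
by rewrite big_ord_recr /= IH; lia.
Qed.

Lemma sum_two_level m1 m2 la mu n :
  (forall l, la l <= mu l <= n) ->
  \sum_(l < n) \sum_(c < n) two_level m1 m2 la mu l c =
  m1 * (\sum_(l < n) la l) + m2 * \sum_(l < n) (mu l - la l).
Proof.
move=> h; rewrite !big_distrr -big_split /=; apply: eq_bigr => l _.
have {}h := h l.
have -> : la l = \sum_(c < n) (c < la l : nat) by rewrite sum_ltn; lia.
have -> : mu l - \sum_(c < n) (c < la l) = \sum_(c < n) (la l <= c < mu l : nat).
  have : \sum_(c < n) (c < mu l : nat) =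
     \sum_(c < n) (c < la l) + \sum_(c < n) (la l <= c < mu l).
    by rewrite -big_split /=; apply: eq_bigr => c _; lia.
  by rewrite !sum_ltn; lia.
rewrite !big_distrr -big_split /=; apply: eq_bigr => c _.
by rewrite /two_level; do ![case: ifP]; lia.
Qed.

(** Row lengths of the hook partition with first row [a] and [p] rows in all. *)
Definition hook_row (a p l : nat) : nat := if l == 0 then a else (l < p : nat).

Lemma hook_row_decr a p l l' : 0 < a -> l <= l' -> hook_row a p l' <= hook_row a p l.
Proof. by rewrite /hook_row; do ![case: eqP]; lia. Qed.

Lemma sum_hook_row n a p : 0 < p <= n -> \sum_(l < n) hook_row a p l = a + p - 1.
Proof.
case: n => [|n]; first lia.
move=> h; rewrite big_ord_recl /hook_row /=.
under eq_bigr => l _ do rewrite /bump /= add1n.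
have -> : \sum_(l < n) (l.+1 < p : nat) = minn p.-1 n.
  by rewrite -sum_ltn; apply: eq_bigr => l _; lia.
lia.
Qed.

(* The rows of the shape obtained from [la] by adding the border strip whose top
   right cell ends row [i] at width [x] and whose bottom left cell is in row [j]:
   below row [i] connectedness without a 2 x 2 square forces row [l] to reach
   exactly one cell beyond [la l.-1]. *)
Definition strip_row (la : nat -> nat) (i j x l : nat) : nat :=
  if l < i then la l else if l == i then x else
  if l <= j then (la l.-1).+1 else la l.

Section Strip.
Variables (la : nat -> nat) (i j x : nat).
Hypotheses (la_decr : forall l l', l <= l' -> la l' <= la l) (ij : i <= j)
  (xi : la i < x) (xi' : 0 < i -> x <= la i.-1).

Let mu := strip_row la i j x.

Lemma strip_row_at : mu i = x.
Proof. by rewrite /mu /strip_row ltnn eqxx. Qed.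

Lemma strip_row_ge l : la l <= mu l.
Proof.
have h2 := @la_decr l.-1 l (leq_pred _).
rewrite /mu /strip_row; case: (ltngtP l i) => hl //.
- by case: ifP; lia.
- by subst l; lia.
Qed.

Lemma strip_row_decr l : mu l.+1 <= mu l.
Proof.
have h1 := @la_decr l l.+1 (leqnSn _); have h2 := @la_decr l.-1 l (leq_pred _).
rewrite /mu /strip_row /=.
case: (ltngtP l i) => hl.
- have hi : 0 < i by lia.
  case: (ltngtP l.+1 i) => hl'.  by [].  by lia.
  by have := xi' hi; rewrite -hl'.
- by do ![case: ifP]; lia.
- by subst l; do ![case: ifP]; lia.
Qed.

Lemma strip_row_nonempty l : (la l < mu l) = (i <= l <= j).
Proof.
have h2 := @la_decr l.-1 l (leq_pred _).
rewrite /mu /strip_row; case: (ltngtP l i) => hl.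
- by lia.
- by do ![case: ifP]; lia.
- by subst l; lia.
Qed.

Lemma strip_row_le l : mu l.+1 <= (la l).+1.
Proof.
have h1 := @la_decr l l.+1 (leqnSn _).
rewrite /mu /strip_row /=; case: (ltngtP l.+1 i) => hl.
- lia.
- by do ![case: ifP]; lia.
- by have := xi'; rewrite -hl /=; lia.
Qed.

(** Below row [i] each strip row ends under a strip cell of the previous row, so a strip owns
    exactly one free cell, at the end of its top row. *)
Lemma strip_row_start l :
  (la l < mu l) && ((l == 0) || (mu l <= la l.-1)) = (l == i).
Proof.
have h2 := @la_decr l.-1 l (leq_pred _).
rewrite /mu /strip_row; case: (ltngtP l i) => hl.
- by lia.
- by do ![case: ifP]; lia.
- subst l; rewrite xi /=; case: (posnP i) => [->|i0] //=.
  by rewrite (xi' i0) ?orbT.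
Qed.

Lemma sum_strip_row n : j < n ->
  \sum_(l < n) (mu l - la l) = x + j - i - la j.
Proof.
move=> jn.
(* Row [l] with [i < l <= j] adds [la l.-1 + 1 - la l], so partial sums telescope; [minn m.-1 j] is
   the last strip row among the first [m] rows. *)
have S m : \sum_(l < m) (mu l - la l) =
   if m <= i then 0 else x + minn m.-1 j - i - la (minn m.-1 j).
  elim: m => [|m IH]; first by rewrite big_ord0.
  rewrite big_ord_recr /= IH /mu /strip_row.
  case: (ltngtP m i) => hm.
  - lia.
  - case: (boolP (m <= j)) => hj.
      have -> : minn m.-1 j = m.-1 by lia.
      have -> : minn m j = m by lia.
      have := @la_decr m.-1 m; have := @la_decr i m.-1.
      lia.
    have -> : minn m.-1 j = j by lia.
    have -> : minn m j = j by lia.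
    lia.
  - subst m; have -> : minn i j = i by lia.
    lia.
rewrite S; have -> : minn n.-1 j = j by lia.
by case: ifP; lia.
Qed.

End Strip.

Lemma tab_get n (e : {ffun 'I_n * 'I_n -> 'I_n.+1}) f :
  (forall i j, get e i j = f i j) -> e = tab n f.
Proof.
by move=> h; apply/ffunP => -[i j]; rewrite ffunE /= -h getE inord_val.
Qed.

Lemma tab_with_free_cells k n r f :
  decreasing_array f -> (forall i j, k <= i -> f i j = 0) ->
  (forall i j, n <= i \/ n <= j -> f i j = 0) ->
  \sum_(i < n) \sum_(j < n) f i j = n ->
  (forall i j, ~~ clash_cell f i j) ->
  #|[set c : 'I_n * 'I_n | free_cell f c.1 c.2]| = r ->
  tab n f \in with_free_cells k n r.
Proof.
move=> hd hk hout hs hc hr; have gE := get_tab hout hs.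
rewrite inE; apply/and3P; split.
- apply/underlying_okP; split.
  + by move=> i j; rewrite !gE; apply: hd.
  + by move=> i j h; rewrite gE hk.
  + by rewrite -[RHS]hs; apply: eq_bigr => i _; apply: eq_bigr => j _; rewrite gE.
- by apply/forallP => c; rewrite (clash_cell_ext _ _ gE).
- rewrite -hr; apply/eqP; apply: eq_card => c.
  by rewrite !inE (free_cell_ext _ _ gE).
Qed.

(** * The region of the largest value in a clash-free array *)

Lemma width n (b : nat -> bool) :
  (forall c, b c.+1 -> b c) -> (forall c, n <= c -> ~~ b c) ->
  exists2 w, w <= n & forall c, b c = (c < w).
Proof.
move=> hb hn; have ex : exists c, ~~ b c by exists n; apply: hn.
case: (ex_minnP ex) => w hw wmin; exists w; first exact: wmin (hn _ _).
move=> c; case: (ltnP c w) => h.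
  by apply: contraTT h => /wmin; rewrite -leqNgt.
apply/negP => bc; move/negP: hw; apply; move: bc; rewrite -(subnK h).
by elim: (c - w) => // d IH; rewrite addSn => /hb.
Qed.

Section Structure.
Variables (k n : nat) (e : {ffun 'I_n * 'I_n -> 'I_n.+1}).
Hypotheses (n_gt0 : 0 < n) (e_ok : underlying_ok k e) (e_cf : clash_free e).

Let f := get e.

Let f_decr : decreasing_array f.
Proof. by case/underlying_okP: e_ok. Qed.

Let f_rows i j : k <= i -> f i j = 0.
Proof. by case/underlying_okP: e_ok => _ h _; apply: h. Qed.

Let f_sum : \sum_(i < n) \sum_(j < n) f i j = n.
Proof. by case/underlying_okP: e_ok. Qed.

Lemma get_gt0_lt i j : 0 < f i j -> (i < n) && (j < n).
Proof.
move=> h; apply/andP; split; rewrite ltnNge; apply/negP => h'; move: h.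
  by rewrite /f get_out_row.
by rewrite /f get_out_col.
Qed.

Lemma get_no_clash l c : 0 < f l.+1 c -> f l.+1 c.+1 = f l.+1 c ->
  f l c = f l.+1 c -> False.
Proof.
move=> p0 E1 E2; case/andP: (get_gt0_lt p0) => hl hc.
have := forallP e_cf (Ordinal hl, Ordinal hc).
by rewrite /clash_cell /nonlast /nonfirst /= -/f E1 E2 p0 !eqxx.
Qed.

Lemma get_le00 l c : f l c <= f 0 0.
Proof. by rewrite (leq_trans (decr_row l f_decr (leq0n c))) // decr_col. Qed.

Lemma get00_gt0 : 0 < f 0 0.
Proof.
rewrite lt0n; apply/eqP => E; move: n_gt0; rewrite -[n in 0 < n]f_sum big1 // => i _.
by rewrite big1 // => j _; apply/eqP; rewrite -leqn0 -E get_le00.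
Qed.

(** The largest value is the corner entry. If it occurred off the first row and column, monotonicity
    would copy it to [(l.+1, 1)], [(l.+1, 0)] and [(l, 0)], a clash at [(l.+1, 0)]; hence it fills a
    hook. *)
Lemma get_hook : exists a p, [/\ 0 < a <= n, 0 < p <= n, p <= k,
  forall l c, (f l c == f 0 0) = (c < hook_row a p l) & free_cell f 0 a.-1].
Proof.
have f0 := get00_gt0.
have lt0 l c : f l c == f 0 0 -> 0 < f l c by move/eqP->.
have [a an aE] : exists2 a, a <= n & forall c, (f 0 c == f 0 0) = (c < a).
  apply: width => c.
    move/eqP => E; rewrite eqn_leq get_le00 /= -[X in X <= _]E.
    exact: (proj1 (f_decr _ _)).
  by move=> h; rewrite /f get_out_col // -/f; move: f0; case: (f 0 0).
have [p pn pE] : exists2 p, p <= n & forall l, (f l 0 == f 0 0) = (l < p).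
  apply: width => c.
    move/eqP => E; rewrite eqn_leq get_le00 /= -[X in X <= _]E.
    exact: (proj2 (f_decr _ _)).
  by move=> h; rewrite /f get_out_row // -/f; move: f0; case: (f 0 0).
have a0 : 0 < a by rewrite -aE.
have p0 : 0 < p by rewrite -pE.
exists a, p; split.
- by rewrite a0.
- by rewrite p0.
- rewrite leqNgt; apply/negP => h.
  have := pE k; rewrite h => /eqP E; move: f0; rewrite -E f_rows //.
- move=> l c; rewrite /hook_row; case: l => [|l] /=; first exact: aE.
  case: c => [|c]; first by rewrite pE; lia.
  rewrite (_ : (_ < _) = false); last by case: (l.+1 < p); lia.
  apply/negP => /eqP E.
  have h1 : f l.+1 1 = f 0 0.
    by apply/eqP; rewrite eqn_leq get_le00 -E; apply: (decr_row _ f_decr).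
  have h2 : f l.+1 0 = f 0 0.
    by apply/eqP; rewrite eqn_leq get_le00 -h1; apply: (decr_row _ f_decr).
  have h3 : f l 0 = f 0 0.
    by apply/eqP; rewrite eqn_leq get_le00 -h2; apply: (decr_col _ f_decr).
  by apply: (@get_no_clash l 0); rewrite ?h1 ?h2 ?h3.
- have E : f 0 a.-1 = f 0 0 by apply/eqP; rewrite aE; lia.
  rewrite /free_cell /nonlast /nonfirst /= andbF E f0 /= prednK // andbT.
  by rewrite aE ltnn.
Qed.

Lemma free_cellsE i j (hi : i < n) (hj : j < n) :
  ((Ordinal hi, Ordinal hj) \in free_cells e) = free_cell f i j.
Proof. by rewrite inE. Qed.

Lemma free_cell_in l c : 0 < f l c ->
  exists2 x, x \in free_cells e & f x.1 x.2 = f l c.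
Proof.
move=> v0.
have hN i j : n <= j -> f i j = 0 by exact: get_out_col.
have [i [j [fij E]]] := free_cell_of_value f_decr hN v0.
have ij0 : 0 < f i j by rewrite E.
case/andP: (get_gt0_lt ij0) => hi hj.
by exists (Ordinal hi, Ordinal hj); rewrite ?free_cellsE.
Qed.

End Structure.

(** * One free cell: a single value on a hook *)

Definition hook_params (k n : nat) : {set 'I_n.+1 * 'I_n.+1 * 'I_k.+1} :=
  [set t : 'I_n.+1 * 'I_n.+1 * 'I_k.+1 |
     [&& 0 < t.2, t.2 <= t.1.2 & t.1.1 * t.1.2 == n]].

(** In [t = (m, s, p)] the entries are value, size and number of rows; a first row of length
    [s + 1 - p] makes the size [s]. *)
Definition hook_array (k n : nat) (t : 'I_n.+1 * 'I_n.+1 * 'I_k.+1) :=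
  let la := hook_row (t.1.2.+1 - t.2) t.2 in
  tab n (two_level t.1.1 0 la la).

Lemma hook_two_level m la l c :
  two_level m 0 la la l c = if c < la l then m else 0.
Proof. by rewrite /two_level; case: ifP => // ->. Qed.

Section HookArray.
Variables (k n : nat) (t : 'I_n.+1 * 'I_n.+1 * 'I_k.+1).
Hypotheses (n_gt0 : 0 < n) (ht : t \in hook_params k n).

Let m : nat := t.1.1.
Let s : nat := t.1.2.
Let p : nat := t.2.
Let la := hook_row (s.+1 - p) p.

Let hp : [/\ 0 < p <= k, p <= s <= n, 0 < m & m * s = n].
Proof.
move: ht; rewrite inE -/p -/s -/m => /and3P[p0 ps /eqP E].
have pk : p <= k by rewrite -ltnS ltn_ord.
have sn : s <= n by rewrite -ltnS ltn_ord.
by split; [lia|lia|nia|].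
Qed.

Let la_decr l l' : l <= l' -> la l' <= la l.
Proof. by case: hp => *; apply: hook_row_decr; lia. Qed.

Lemma hook_array_out l c : n <= l \/ n <= c -> two_level m 0 la la l c = 0.
Proof.
case: hp => hpk hps m0 E; rewrite hook_two_level /la /hook_row => h.
by case: ifP => //; case: eqP; case: (ltnP l p); lia.
Qed.

Lemma hook_array_sum : \sum_(l < n) \sum_(c < n) two_level m 0 la la l c = n.
Proof.
case: hp => hpk hps m0 E; rewrite sum_two_level.
  rewrite mul0n addn0 sum_hook_row; last lia.
  by rewrite -[RHS]E; congr (_ * _); lia.
move=> l; rewrite leqnn /=; apply: (leq_trans (la_decr (leq0n l))).
by rewrite /la /hook_row /=; lia.
Qed.

Lemma get_hook_array l c : get (hook_array t) l c = if c < la l then m else 0.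
Proof.
by rewrite (get_tab hook_array_out hook_array_sum) hook_two_level.
Qed.

Lemma hook_array_in : hook_array t \in with_free_cells k n 1.
Proof.
case: hp => hpk hps m0 E.
have h1 l : la l < la l -> 0 < 0 < m by rewrite ltnn.
have h2 l : la l.+1 <= la l by apply: la_decr.
apply: tab_with_free_cells.
- exact: two_level_decreasing.
- move=> l c h; rewrite hook_two_level /la /hook_row.
  by case: ifP => //; case: eqP; case: (ltnP l p); lia.
- exact: hook_array_out.
- exact: hook_array_sum.
- move=> l c; apply: two_level_clash => // l'; split.
    by rewrite /la /hook_row /=; case: (_ < _).
  by rewrite (leq_trans (h2 l')).
- have hc : (s - p) < n by lia.
  rewrite (_ : [set _ | _] = [set (Ordinal n_gt0, Ordinal hc)]) ?cards1 //.
  apply/setP => -[l c]; rewrite !inE /= two_level_free // ltnn andbF orbF.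
  rewrite xpair_eqE -!val_eqE /= /hook_row /la /=; congr (_ && _).
  by apply/eqP/eqP; lia.
Qed.

End HookArray.

Lemma hook_array_inj k n : 0 < n -> {in hook_params k n &, injective (@hook_array k n)}.
Proof.
move=> n0 t t' ht ht' E.
have G l c := get_hook_array n0 ht l c.
have G' l c := get_hook_array n0 ht' l c.
move: G G' ht ht'; rewrite !inE -E.
case: t t' {E} => [[m s] p] [[m' s'] p'] /= G G' /and3P[p0 ps /eqP En].
move=> /and3P[p0' ps' /eqP En'].
have m0 : 0 < m by nia.
have m0' : 0 < m' by nia.
have mm : m = m' :> nat.
  have := G 0 0; rewrite G' /hook_row /=.
  by rewrite !ifT //; lia.
have ss : s = s' :> nat.
  by apply/eqP; rewrite -(eqn_pmul2l m0) En mm En'.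
have pp : p = p' :> nat.
  have := G p 0; have := G p' 0; rewrite !G' /hook_row /=.
  have -> : (p == 0 :> nat) = false by lia.
  have -> : (p' == 0 :> nat) = false by lia.
  by do ![case: ifP]; lia.
by congr (_, _, _); apply: val_inj.
Qed.

(** Every positive value owns a free cell, and the only one carries the largest value, so no other
    positive value occurs. *)
Lemma hook_array_surj k n e : 0 < n -> e \in with_free_cells k n 1 ->
  exists2 t, t \in hook_params k n & e = hook_array t.
Proof.
move=> n0; rewrite inE => /and3P[ok cf /cards1P[x0 Fx]].
have [a [p [ha hp pk laE fa]]] := get_hook n0 ok cf.
have f0 := get00_gt0 n0 ok.
set f := get e in laE fa f0 *; set m := f 0 0 in laE f0 *.
have a1 : a.-1 < n by lia.
have c0 : (Ordinal n0, Ordinal a1) = x0.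
  by apply/set1P; rewrite -Fx free_cellsE.
have vE l c : f l c = two_level m 0 (hook_row a p) (hook_row a p) l c.
  rewrite hook_two_level -laE; case: (posnP (f l c)) => [->|v0].
    by case: eqP.
  have [x] := free_cell_in ok v0; rewrite Fx inE => /eqP ->; rewrite -/f => <-.
  rewrite -c0 /= (_ : f 0 a.-1 = m) ?eqxx //.
  by apply/eqP; rewrite laE /hook_row /=; lia.
have sE : m * (a + p - 1) = n.
  case/underlying_okP: (ok) => _ _ hs; rewrite -[RHS]hs.
  under eq_bigr do under eq_bigr do rewrite -/f vE.
  rewrite sum_two_level ?sum_hook_row //; first lia.
  move=> l; rewrite /hook_row; case: eqP; case: ltnP; lia.
have mn : m < n.+1 by nia.
have sn : (a + p - 1) < n.+1 by nia.
exists (Ordinal mn, Ordinal sn, inord p).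
  by rewrite inE /= inordK //; apply/and3P; split; [lia|lia|apply/eqP].
apply: tab_get => i j; rewrite -/f vE /= inordK //.
by have -> : (a + p - 1).+1 - p = a by lia.
Qed.

Lemma card_with_one_free_cell k n : 0 < n ->
  #|with_free_cells k n 1| = #|hook_params k n|.
Proof.
move=> n0; rewrite -(card_in_imset (hook_array_inj n0)); apply: eq_card => e.
apply/idP/imsetP => [he|[t ht ->]]; last exact: hook_array_in.
by have [t ht ->] := hook_array_surj n0 he; exists t.
Qed.

(* Here [la] is the hook of size [s1] with [p] rows.  A strip of size [s2] in rows
   [i] to [j] ends row [i] at width [x = s2 + la j + i - j], and the last two
   conditions are [la i < x <= la i.-1], stated without truncated subtraction. *)
Definition strip_cond (s1 s2 p i j : nat) : bool :=
  let la := hook_row (s1.+1 - p) p in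
  [&& 0 < p <= s1, i <= j, la i + j < s2 + la j + i
    & (i == 0) || (s2 + la j + i <= la i.-1 + j)].

(** * Two free cells: a hook surrounded by a strip *)

Notation strip_paramT k n :=
  ('I_n.+1 * 'I_n.+1 * ('I_n.+1 * 'I_n.+1) * ('I_k.+1 * ('I_k * 'I_k)))%type.

(** The coordinates are the values [m1, m2], the sizes [s1, s2], the number [p] of hook rows, and
    the first and last strip rows [i, j]. The bounds [p <= k] and [i, j < k] sit in the types. *)
Definition strip_params (k n : nat) : {set strip_paramT k n} :=
  [set t : strip_paramT k n |
     [&& 0 < t.1.1.2 < t.1.1.1,
         t.1.1.1 * t.1.2.1 + t.1.1.2 * t.1.2.2 == n
       & strip_cond t.1.2.1 t.1.2.2 t.2.1 t.2.2.1 t.2.2.2]].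

Definition strip_fun (m1 m2 s1 s2 p i j : nat) :=
  let la := hook_row (s1.+1 - p) p in
  two_level m1 m2 la (strip_row la i j (s2 + la j + i - j)).

Definition strip_array (k n : nat) (t : strip_paramT k n) :=
  tab n (strip_fun t.1.1.1 t.1.1.2 t.1.2.1 t.1.2.2 t.2.1 t.2.2.1 t.2.2.2).

Section StripArray.
Variables (k n m1 m2 s1 s2 p i j : nat).
Hypotheses (pk : p <= k) (jk : j < k) (hm : 0 < m2 < m1)
  (hn : m1 * s1 + m2 * s2 = n) (hc : strip_cond s1 s2 p i j).

Let la := hook_row (s1.+1 - p) p.
Let x := s2 + la j + i - j.
Let mu := strip_row la i j x.

Let p_le : 0 < p <= s1.
Proof. by case/and4P: hc. Qed.

Let ij : i <= j.
Proof. by case/and4P: hc. Qed.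

Let la_decr l l' : l <= l' -> la l' <= la l.
Proof. by move=> *; apply: hook_row_decr; lia. Qed.

Let xi : la i < x.
Proof. by case/and4P: hc => _ _; rewrite /x -/la; lia. Qed.

Let xi' : 0 < i -> x <= la i.-1.
Proof. by case/and4P: hc => _ _ _; rewrite /x -/la; lia. Qed.

Let s2E : x + j - i - la j = s2.
Proof. by have := la_decr ij; have := xi; rewrite /x; lia. Qed.

Let s12 : s1 + s2 <= n.
Proof. by rewrite -hn; nia. Qed.

Let la0 : la 0 = s1.+1 - p.
Proof. by []. Qed.

Let la_out l : p <= l -> la l = 0.
Proof. by rewrite /la /hook_row; case: eqP; case: ltnP; lia. Qed.

Let i_le : i <= p.
Proof.
rewrite leqNgt; apply/negP => h; have := xi' (leq_ltn_trans (leq0n _) h).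
by have := @la_out i.-1; have := xi; lia.
Qed.

Let j_lt : j < n.
Proof. by have := la_decr ij; have := xi; rewrite /x; lia. Qed.

Let mu_le l : la l <= mu l <= n.
Proof.
rewrite strip_row_ge //=.
have : mu l <= mu 0.
  elim: l => // l IH; apply: leq_trans IH; exact: strip_row_decr.
rewrite {2}/mu /strip_row /=; have := la_decr (leq0n j); have := ij.
by rewrite /x la0; do ![case: ifP]; lia.
Qed.

Let mu_out l : p <= l -> j < l -> mu l = 0.
Proof.
move=> h1 h2; have := strip_row_nonempty la_decr ij xi xi' l.
by rewrite -/mu la_out //; lia.
Qed.

Lemma strip_fun_out l c : n <= l \/ n <= c -> strip_fun m1 m2 s1 s2 p i j l c = 0.
Proof.
rewrite /strip_fun -/la -/x -/mu /two_level => h; have := mu_le l.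
case: h => h; last by do ![case: ifP]; lia.
by rewrite mu_out ?la_out //; lia.
Qed.

Lemma strip_fun_rows l c : k <= l -> strip_fun m1 m2 s1 s2 p i j l c = 0.
Proof.
rewrite /strip_fun -/la -/x -/mu /two_level => h.
by rewrite mu_out ?la_out //; lia.
Qed.

Lemma strip_fun_sum :
  \sum_(l < n) \sum_(c < n) strip_fun m1 m2 s1 s2 p i j l c = n.
Proof.
rewrite /strip_fun -/la -/x -/mu sum_two_level // sum_hook_row; last lia.
rewrite sum_strip_row // s2E -[RHS]hn; congr (_ * _ + _); lia.
Qed.

Lemma strip_fun_in :
  tab n (strip_fun m1 m2 s1 s2 p i j) \in with_free_cells k n 2.
Proof.
have h1 l : la l < mu l -> 0 < m2 < m1 by [].
have h2 l : la l.+1 <= la l by apply: la_decr.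
have h3 l : mu l.+1 <= mu l by apply: strip_row_decr.
have h4 l : la l <= mu l by apply: strip_row_ge.
apply: tab_with_free_cells.
- by apply: two_level_decreasing => //; lia.
- exact: strip_fun_rows.
- exact: strip_fun_out.
- exact: strip_fun_sum.
- move=> l c; apply: two_level_clash => //; first lia.
  move=> l'; split; first by rewrite /hook_row /=; case: (_ < _).
  exact: strip_row_le.
- have n0 : 0 < n by lia.
  have hc1 : (s1 - p) < n by lia.
  have hi : i < n by lia.
  have hx : x.-1 < n by have := mu_le i; rewrite /mu strip_row_at; lia.
  (* The free cells are the end of the hook's first row and the end of strip row [i]; they differ
     even for [i = 0], since [x] exceeds [la i]. *)
  rewrite (_ : [set _ | _] =
     [set (Ordinal n0, Ordinal hc1); (Ordinal hi, Ordinal hx)]).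
    rewrite cards2 xpair_eqE -!val_eqE /=.
    suff -> : (0 == i) && (s1 - p == x.-1) = false by [].
    by apply/negP => /andP[/eqP i0 /eqP E]; have := xi; rewrite -i0 la0; lia.
  apply/setP => -[l c]; rewrite !inE /= two_level_free //; last lia.
  rewrite -/la -/x -/mu strip_row_start // !xpair_eqE -!val_eqE /=; congr (_ || _).
    by congr (_ && _); rewrite la0; apply/eqP/eqP; lia.
  rewrite andbC; case: eqP => //= ->; rewrite /mu strip_row_at.
  by apply/eqP/eqP; lia.
Qed.

Lemma strip_fun_lt_la l c : (strip_fun m1 m2 s1 s2 p i j l c == m1) = (c < la l).
Proof. by rewrite /strip_fun -/la /two_level; do ![case: ifP]; lia. Qed.

Lemma strip_fun_lt_mu l c : (0 < strip_fun m1 m2 s1 s2 p i j l c) = (c < mu l).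
Proof.
rewrite /strip_fun -/la -/x -/mu /two_level; have := mu_le l.
by do ![case: ifP]; lia.
Qed.

Lemma strip_fun_00 : strip_fun m1 m2 s1 s2 p i j 0 0 = m1.
Proof. by apply/eqP; rewrite strip_fun_lt_la la0; lia. Qed.

Lemma strip_fun_start : strip_fun m1 m2 s1 s2 p i j i x.-1 = m2.
Proof.
rewrite /strip_fun -/la -/x -/mu /two_level /mu strip_row_at.
by have := xi; do ![case: ifP]; lia.
Qed.

Lemma strip_fun_nonempty l : (la l < mu l) = (i <= l <= j).
Proof. exact: strip_row_nonempty. Qed.

Lemma strip_fun_width : mu i = s2 + la j + i - j /\ s2 = x + j - i - la j.
Proof. by rewrite /mu strip_row_at s2E. Qed.

End StripArray.

Lemma ltn_ext a b : (forall c, (c < a) = (c < b)) -> a = b.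
Proof. by move=> h; have := h a; have := h b; rewrite !ltnn; lia. Qed.

(** All parameters can be read off the array: [m1] is the corner entry, its region gives the hook,
    the support gives the outer shape, the rows where the two differ give [i] and [j], the width of
    row [i] gives [s2], and its last entry is [m2]. *)
Lemma strip_fun_inj k n m1 m2 s1 s2 p i j m1' m2' s1' s2' p' i' j' :
  p <= k -> j < k -> 0 < m2 < m1 -> m1 * s1 + m2 * s2 = n ->
  strip_cond s1 s2 p i j ->
  p' <= k -> j' < k -> 0 < m2' < m1' -> m1' * s1' + m2' * s2' = n ->
  strip_cond s1' s2' p' i' j' ->
  (forall l c, strip_fun m1 m2 s1 s2 p i j l c
               = strip_fun m1' m2' s1' s2' p' i' j' l c) ->
  [/\ m1 = m1', m2 = m2', s1 = s1' & s2 = s2'] /\ [/\ p = p', i = i' & j = j'].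
Proof.
move=> pk jk hm hn hc pk' jk' hm' hn' hc' E.
have hp : 0 < p <= s1 by case/and4P: hc.
have hp' : 0 < p' <= s1' by case/and4P: hc'.
have hij : i <= j by case/and4P: hc.
have hij' : i' <= j' by case/and4P: hc'.
have E1 : m1 = m1'.
  by rewrite -(strip_fun_00 pk jk hm hn hc) E (strip_fun_00 pk' jk' hm' hn' hc').
have laE l : hook_row (s1.+1 - p) p l = hook_row (s1'.+1 - p') p' l.
  apply: ltn_ext => c.
  by rewrite -(strip_fun_lt_la pk jk hm hn hc) E E1 (strip_fun_lt_la pk' jk' hm' hn' hc').
have pE : p = p'.
  have := laE p; have := laE p'; rewrite /hook_row.
  have -> : (p == 0) = false by lia.
  have -> : (p' == 0) = false by lia.
  by rewrite !ltnn; case: ltngtP.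
have s1E : s1 = s1' by have := laE 0; rewrite /hook_row /=; lia.
subst m1' p' s1'.
set la := hook_row (s1.+1 - p) p in laE.
have muE l : strip_row la i j (s2 + la j + i - j) l =
             strip_row la i' j' (s2' + la j' + i' - j') l.
  apply: ltn_ext => c.
  by rewrite -(strip_fun_lt_mu pk jk hm hn hc) E (strip_fun_lt_mu pk' jk' hm' hn' hc').
have ne l := strip_fun_nonempty pk jk hm hn hc l.
have ne' l := strip_fun_nonempty pk' jk' hm' hn' hc' l.
have neE l : (i <= l <= j) = (i' <= l <= j') by rewrite -ne -ne' -/la muE.
have iE : i = i' by have := neE i; have := neE i'; lia.
have jE : j = j' by have := neE j; have := neE j'; lia.
subst i' j'.
have [w1 w2] := strip_fun_width pk jk hm hn hc.
have [w1' w2'] := strip_fun_width pk' jk' hm' hn' hc'.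
rewrite -/la in w1 w2 w1' w2'.
have s2E : s2 = s2' by rewrite w2 w2' -w1 -w1' muE.
subst s2'.
have m2E : m2 = m2'.
  by rewrite -(strip_fun_start pk jk hm hn hc) E (strip_fun_start pk' jk' hm' hn' hc').
by subst m2'.
Qed.

Lemma strip_paramsP k n (t : strip_paramT k n) : t \in strip_params k n ->
  [/\ t.2.1 <= k, t.2.2.2 < k, 0 < t.1.1.2 < t.1.1.1,
      t.1.1.1 * t.1.2.1 + t.1.1.2 * t.1.2.2 = n
    & strip_cond t.1.2.1 t.1.2.2 t.2.1 t.2.2.1 t.2.2.2].
Proof.
rewrite inE => /and3P[h1 /eqP h2 h3]; split=> //.
by rewrite -ltnS ltn_ord.
Qed.

Lemma strip_array_inj k n : {in strip_params k n &, injective (@strip_array k n)}.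
Proof.
move=> t t' /strip_paramsP[h1 h2 h3 h4 h5] /strip_paramsP[h1' h2' h3' h4' h5'] E.
have := strip_fun_inj h1 h2 h3 h4 h5 h1' h2' h3' h4' h5'.
case=> [l c|].
  rewrite -(get_tab (strip_fun_out h1 h2 h3 h4 h5) (strip_fun_sum h1 h2 h3 h4 h5)).
  rewrite -(get_tab (strip_fun_out h1' h2' h3' h4' h5') (strip_fun_sum h1' h2' h3' h4' h5')).
  by rewrite -/(strip_array t) -/(strip_array t') E.
move=> {E h1 h2 h3 h4 h5 h1' h2' h3' h4' h5'}.
case: t t' => [[[m1 m2] [s1 s2]] [p [i j]]] [[[m1' m2'] [s1' s2']] [p' [i' j']]] /=.
by move=> [/val_inj-> /val_inj-> /val_inj-> /val_inj->] [/val_inj-> /val_inj-> /val_inj->].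
Qed.

(** One free cell ends the first row of the hook of the largest value. The other is the only one
    available to a second value, which forces the remaining cells to form a single border strip. *)
Lemma strip_array_surj k n e : 0 < n -> e \in with_free_cells k n 2 ->
  exists2 t, t \in strip_params k n & e = strip_array t.
Proof.
move=> n0; rewrite inE => /and3P[ok cf /cards2P[x0 [x1 [x01 Fx]]]].
have [a [p [ha hp pk laE fa]]] := get_hook n0 ok cf.
have f0 := get00_gt0 n0 ok.
have le00 := get_le00 ok.
have noclash := get_no_clash cf.
have gt0_lt i j : 0 < get e i j -> (i < n) && (j < n) := @get_gt0_lt n e i j.
have fin l c := @free_cell_in k n e ok l c.
have /underlying_okP[hd hk hs] := ok.
have inF l c : free_cell (get e) l c ->
   exists2 x, x \in free_cells e & l = x.1 /\ c = x.2.
  move=> h; have v0 : 0 < get e l c by case/and3P: h.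
  case/andP: (gt0_lt _ _ v0) => hl hc.
  by exists (Ordinal hl, Ordinal hc); rewrite ?free_cellsE.
set f := get e in laE fa f0 le00 noclash gt0_lt fin hd hk hs inF *.
set m1 := f 0 0 in laE f0 le00 *; set la := hook_row a p in laE *.
have fa1 : f 0 a.-1 = m1 by apply/eqP; rewrite laE /la /hook_row /=; lia.
have la_decr l l' : l <= l' -> la l' <= la l by apply: hook_row_decr; lia.
(* [y] is the free cell other than the end of the hook's first row. *)
have [y [yF yE Fy]] : exists y, [/\ y \in free_cells e, (y.1 != 0 :> nat) || (y.2 != a.-1 :> nat)
    & forall x, x \in free_cells e ->
        (x.1 = 0 :> nat /\ x.2 = a.-1 :> nat) \/ x = y].
  have a1 : a.-1 < n by lia.
  pose z := (Ordinal n0, Ordinal a1).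
  have zF : z \in free_cells e by rewrite free_cellsE.
  have zneq y : y != z -> (y.1 != 0 :> nat) || (y.2 != a.-1 :> nat).
    by case: y => y1 y2; rewrite xpair_eqE -!val_eqE /= negb_and.
  move: (zF); rewrite Fx !inE => /orP[] /eqP zE.
    exists x1; split; first by rewrite !inE eqxx orbT.
      by apply: zneq; rewrite zE eq_sym.
    by move=> x; rewrite !inE -zE => /orP[/eqP->|/eqP->]; [left|right].
  exists x0; split; first by rewrite !inE eqxx.
    by apply: zneq; rewrite zE.
  by move=> x; rewrite !inE -zE => /orP[/eqP->|/eqP->]; [right|left].
case: y yF yE Fy => i x' yF /= yE Fy.
set x := x'.+1.
have fy : free_cell f i x' by rewrite inE in yF.
set m2 := f i x'.
have m20 : 0 < m2 by case/and3P: fy.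
(* Each positive value owns a free cell, so at most two positive values occur. *)
have val l c : [|| f l c == m1, f l c == m2 | f l c == 0].
  case: (posnP (f l c)) => [->|v0]; first by rewrite ?eqxx !orbT.
  have [z zF <-] := fin _ _ v0; case: (Fy z zF) => [[-> ->]|->].
    by rewrite fa1 eqxx.
  by rewrite /= eqxx !orbT.
(* Were the values equal, the second free cell would lie in the hook, with an equal right neighbour
   in row 0 or an equal upper neighbour below it. *)
have m2m1 : m2 < m1.
  rewrite ltn_neqAle le00 andbT; apply/negP => E.
  have hx : x' < la i by rewrite -laE.
  case/and3P: fy => _; rewrite /nonlast /nonfirst -/m2 m20 /=.
  case: (posnP i) => i0 /=.
    have hl : x'.+1 < la i by move: yE hx; rewrite i0 /la /hook_row /=; lia.
    by rewrite (eqP E); move: hl; rewrite -laE => ->.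
  have -> : f i.-1 x' == m2.
    by rewrite (eqP E) laE; apply: (leq_trans hx); apply: la_decr; lia.
  by [].
have [mu muE] : exists mu : nat -> nat, forall l c, (0 < f l c) = (c < mu l).
  exists (fun l => \sum_(c < n) (0 < f l c : nat)) => l c.
  have [w wn wE] : exists2 w, w <= n & forall c, (0 < f l c) = (c < w).
    apply: width => c'; first by move=> h; apply: (leq_trans h); apply: (proj1 (hd _ _)).
    by move=> h; rewrite /f get_out_col.
  under eq_bigr do rewrite wE.
  by rewrite sum_ltn wE; lia.
have fE l c : f l c = two_level m1 m2 la mu l c.
  rewrite /two_level -laE -muE; have := val l c.
  by case: eqP => [->|_] //=; case: eqP => [->|_] /=; [rewrite m20|move=> /eqP->].
have la_mu l : la l <= mu l.
  rewrite leqNgt; apply/negP => h; have := muE l (mu l).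
  have -> : f l (mu l) = m1 by apply/eqP; rewrite laE.
  by rewrite f0 ltnn.
have mu_decr l : mu l.+1 <= mu l.
  rewrite leqNgt -muE; apply/negP => h.
  by have := muE l (mu l); rewrite ltnn (leq_trans h (proj2 (hd _ _))).
(* Otherwise the strip contains [(l, la l)], [(l.+1, la l)] and [(l.+1, (la l).+1)], a clash. *)
have mu_le l : mu l.+1 <= (la l).+1.
  rewrite leqNgt; apply/negP => h; have := @noclash l (la l).
  have := la_decr l l.+1 (leqnSn _); have := mu_decr l.
  by rewrite !fE /two_level; do ![case: ifP]; lia.
(* A strip row whose end is not below a strip cell ends in a free cell, which can only be [y]. *)
have start l : (la l < mu l) -> (l == 0) || (mu l <= la l.-1) -> l = i /\ mu l = x.
  move=> h1 h2; have hF : free_cell f l (mu l).-1.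
    rewrite (free_cell_ext _ _ fE) two_level_free //; last first.
    - by move=> l'; apply: la_decr.
    - by move=> *; rewrite m20.
    by rewrite h1 h2 /= prednK ?eqxx ?orbT //; lia.
  have [z zF [E1 E2]] := inF _ _ hF; case: (Fy z zF) => E.
    have : f l (mu l).-1 = m1 by rewrite E2 E1 (proj1 E) (proj2 E).
    rewrite fE /two_level.
    by do ![case: ifP]; lia.
  by rewrite E /= in E1 E2; split=> //; rewrite /x -E2 prednK //; lia.
have fyE := fy; rewrite (free_cell_ext _ _ fE) two_level_free // in fyE; last first.
- by move=> l'; apply: la_decr.
- by move=> *; rewrite m20.
have {fyE} [mui lai xi'] : [/\ mu i = x, la i < x & (0 < i -> x <= la i.-1)].
  case/orP: fyE => [/andP[/eqP i0 /eqP E]|/and3P[/eqP E h1 h2]].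
    by move: yE; rewrite i0 /=; move: E; rewrite /la /hook_row /=; lia.
  by rewrite /x E; split=> //; lia.
(* Hence every nonempty strip row other than [i] hangs from a nonempty row above, and the nonempty
   rows form an interval starting at [i]. *)
have ne_pred l : la l.+1 < mu l.+1 -> l.+1 != i -> la l < mu l.
  move=> h /eqP hi; have := start l.+1 h; have := mu_decr l.
  by case: (leqP (mu l.+1) (la l)) => /= h1 h2 h3; [case: h3|lia].
have ne_ge l : la l < mu l -> i <= l.
  elim: l => [|l IH] h; first by have [<-] := start 0 h isT.
  by case: (l.+1 =P i) => [->//|/eqP hi]; rewrite (leq_trans (IH (ne_pred _ h hi))).
have ne_i : la i < mu i by rewrite mui.
have ne_ub l : la l < mu l -> l <= n.
  move=> h; have : 0 < f l (la l) by rewrite muE.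
  by move/gt0_lt; lia.
case: (ex_maxnP (ex_intro _ (i : nat) ne_i) ne_ub) => j ne_j jmax.
have ij : i <= j by apply: ne_ge.
have ne_mid d : i + d <= j -> la (j - d) < mu (j - d).
  elim: d => [|d IH] h; first by rewrite subn0.
  apply: ne_pred; have -> : (j - d.+1).+1 = j - d by lia.
    by apply: IH; lia.
  lia.
(* Strictly below row [i], [start] gives [mu l > la l.-1] and [mu_le] gives [mu l <= (la l.-1).+1],
   so the width is forced. *)
have muS l : mu l = strip_row la i j x l.
  rewrite /strip_row; case: (ltngtP l i) => hl.
  - by have := ne_ge l; have := la_mu l; lia.
  - case: (leqP l j) => hj.
      have h1 := ne_mid (j - l); have h2 := start l.
      have h3 := mu_le l.-1; rewrite prednK in h3; last lia.
      have E : j - (j - l) = l by lia.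
      rewrite E in h1.
      have {}h1 : la l < mu l by apply: h1; lia.
      case: (leqP (mu l) (la l.-1)) => h4; last lia.
      by case: h2 => //; [rewrite h4 orbT|lia].
    by have := jmax l; have := la_mu l; lia.
  - by rewrite hl.
have jk : j < k.
  rewrite ltnNge; apply/negP => h; have : 0 < f j (la j) by rewrite muE.
  by rewrite hk.
have jn : j < n.
  have : 0 < f j (la j) by rewrite muE.
  by move/gt0_lt/andP=> [].
have lam_n l : la l <= mu l <= n.
  rewrite la_mu leqNgt -muE; apply/negP => /gt0_lt; lia.
pose s1 := a + p - 1; pose s2 := x + j - i - la j.
have s1E : s1.+1 - p = a by rewrite /s1; lia.
have laij := la_decr i j ij.
have s2E : s2 + la j + i - j = x by rewrite /s2; lia.
have sE : m1 * s1 + m2 * s2 = n.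
  rewrite -[RHS]hs; under eq_bigr do under eq_bigr do rewrite -/f fE.
  rewrite sum_two_level // sum_hook_row //; congr (_ + _ * _).
  by under eq_bigr do rewrite muS; rewrite sum_strip_row.
have m1n : m1 < n.+1 by nia.
have m2n : m2 < n.+1 by nia.
have s1n : s1 < n.+1 by nia.
have s2n : s2 < n.+1 by nia.
have ik : i < k by lia.
exists (Ordinal m1n, Ordinal m2n, (Ordinal s1n, Ordinal s2n),
        (inord p, (Ordinal ik, Ordinal jk))).
  rewrite inE /= inordK // m20 m2m1 sE eqxx /strip_cond s1E -/la.
  by rewrite /s1 /s2; apply/and4P; split; lia.
apply: tab_get => l c; rewrite -/f fE /= inordK // /strip_fun s1E -/la s2E.
by rewrite /two_level muS.
Qed.

Lemma card_with_two_free_cells k n : 0 < n ->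
  #|with_free_cells k n 2| = #|strip_params k n|.
Proof.
move=> n0; rewrite -(card_in_imset (@strip_array_inj k n)); apply: eq_card => e.
apply/idP/imsetP => [he|[t /strip_paramsP[h1 h2 h3 h4 h5] ->]].
  by have [t ht ->] := strip_array_surj n0 he; exists t.
exact: strip_fun_in.
Qed.

(** * Parity of the number of strips *)

(** Passage from indexed sums to list sums, the form that is evaluated by [vm_compute]. *)
Lemma sum_iota n (F : nat -> nat) : \sum_(i < n) F i = sumn [seq F i | i <- iota 0 n].
Proof.
rewrite sumnE big_map -(big_mkord xpredT F) /index_iota subn0 //.
Qed.

Lemma eq_odd_sum (I : Type) (r : seq I) (P : pred I) (F G : I -> nat) :
  (forall i, P i -> odd (F i) = odd (G i)) ->
  odd (\sum_(i <- r | P i) F i) = odd (\sum_(i <- r | P i) G i).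
Proof.
by move=> h; elim/big_rec2: _ => // i x y Pi E; rewrite !oddD h // E.
Qed.

Lemma sum_eq_ord N m : \sum_(i < N) (i == m :> nat : nat) = (m < N).
Proof.
elim: N => [|N IH]; first by rewrite big_ord0.
by rewrite big_ord_recr /= IH; lia.
Qed.

Definition strip_count (k s1 s2 : nat) : nat :=
  \sum_(p < k.+1) \sum_(i < k) \sum_(j < k) strip_cond s1 s2 p i j.

(** For sizes at least [2 k], the conditions on row widths are either constant or depend on
    [s2 - s1] alone. *)
Lemma strip_count_shift k s1 s2 : k.*2 <= s1 -> k.*2 <= s2 ->
  strip_count k s1.+1 s2.+1 = strip_count k s1 s2.
Proof.
move=> h1 h2; apply: eq_bigr => p _; apply: eq_bigr => i _; apply: eq_bigr => j _.
congr nat_of_bool; rewrite /strip_cond /hook_row.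
have := ltn_ord p; have := ltn_ord i; have := ltn_ord j.
by do ![case: eqP]; lia.
Qed.

(** When one size exceeds the other by [2 k], every comparison involving both is already decided. *)
Lemma strip_count_shift1 k s1 s2 : k.*2 <= s1 -> s2 + k.*2 <= s1 ->
  strip_count k s1.+1 s2 = strip_count k s1 s2.
Proof.
move=> h1 h2; apply: eq_bigr => p _; apply: eq_bigr => i _; apply: eq_bigr => j _.
congr nat_of_bool; rewrite /strip_cond /hook_row.
have := ltn_ord p; have := ltn_ord i; have := ltn_ord j.
by do ![case: eqP]; lia.
Qed.

Lemma strip_count_shift2 k s1 s2 : k.*2 <= s2 -> s1 + k.*2 <= s2 ->
  strip_count k s1 s2.+1 = strip_count k s1 s2.
Proof.
move=> h1 h2; apply: eq_bigr => p _; apply: eq_bigr => i _; apply: eq_bigr => j _.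
congr nat_of_bool; rewrite /strip_cond /hook_row.
have := ltn_ord p; have := ltn_ord i; have := ltn_ord j.
by do ![case: eqP]; lia.
Qed.

Definition near_parity (k r s : nat) : bool := odd (s - r) && (s - r < k).

(* The correction to [near_parity] for sizes [r < s < k]. *)
Definition small_parity (k r s : nat) : bool :=
  (s < k) && ((odd (s - r) && (r + s <= k)) || (odd r && odd s)).

Definition strip_parity (k r s : nat) : bool :=
  let lo := minn r s in let hi := maxn r s in
  (0 < lo < hi) && (near_parity k lo hi (+) small_parity k lo hi).

Lemma strip_parity_shift k r s : k <= r -> k <= s ->
  strip_parity k r.+1 s.+1 = strip_parity k r s.
Proof.
move=> hr hs; rewrite /strip_parity /near_parity /small_parity minnSS maxnSS subSS.
have -> : (maxn r s < k) = false by lia.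
have -> : ((maxn r s).+1 < k) = false by lia.
have [k0|k0] := posnP k; first by rewrite k0 !ltn0 !andbF.
by congr (_ && _); lia.
Qed.

Lemma strip_parity_far k r s : r + k <= s \/ s + k <= r -> strip_parity k r s = false.
Proof.
move=> h; rewrite /strip_parity /near_parity /small_parity.
have -> : (maxn r s < k) = false by lia.
have -> : (maxn r s - minn r s < k) = false by lia.
by rewrite !andbF.
Qed.

Definition strip_parity_check (k s1 s2 : nat) : bool :=
  odd (sumn [seq sumn [seq sumn [seq (strip_cond s1 s2 p i j : nat)
     | j <- iota 0 k] | i <- iota 0 k] | p <- iota 0 k.+1]) == strip_parity k s1 s2.

(* The inequalities in [strip_cond] compare [s1], [s2] and [s2 - s1] with constants
   of absolute value at most [2 k], so sizes up to [4 k] decide all the others. *)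
Lemma odd_strip_count k :
  all (fun s1 => all (strip_parity_check k s1) (iota 0 (4 * k).+1))
      (iota 0 (4 * k).+1) ->
  forall s1 s2, odd (strip_count k s1 s2) = strip_parity k s1 s2.
Proof.
move=> chk s1 s2; have [m] := ubnP (s1 + s2); elim: m s1 s2 => // m IH s1 s2 hm.
case: (leqP s1 (4 * k)) => h1.
  case: (leqP s2 (4 * k)) => h2.
    have /allP/(_ s1) := chk; rewrite mem_iota => /(_ h1)/allP/(_ s2).
    rewrite mem_iota => /(_ h2)/eqP <-; congr odd.
    rewrite /strip_count (sum_iota _ (fun p => \sum_(i < k) \sum_(j < k)
                                                strip_cond s1 s2 p i j)).
    congr sumn; apply: eq_map => p.
    rewrite (sum_iota _ (fun i => \sum_(j < k) strip_cond s1 s2 p i j)).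
    congr sumn; apply: eq_map => i.
    exact: (sum_iota _ (fun j => strip_cond s1 s2 p i j : nat)).
  case: s2 hm h2 => // s2 hm h2.
  case: (leqP s1 k.*2) => h3.
    by rewrite strip_count_shift2 ?IH ?strip_parity_far //; lia.
  case: s1 hm h1 h3 => // s1 hm h1 h3.
  by rewrite strip_count_shift ?IH ?strip_parity_shift //; lia.
case: s1 hm h1 => // s1 hm h1.
case: (leqP s2 k.*2) => h3.
  by rewrite strip_count_shift1 ?IH ?strip_parity_far //; lia.
case: s2 hm h3 => // s2 hm h3.
by rewrite strip_count_shift ?IH ?strip_parity_shift //; lia.
Qed.

Lemma odd_strip_count4 s1 s2 : odd (strip_count 4 s1 s2) = strip_parity 4 s1 s2.
Proof. by apply: odd_strip_count; vm_compute. Qed.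

Lemma odd_strip_count8 s1 s2 : odd (strip_count 8 s1 s2) = strip_parity 8 s1 s2.
Proof. by apply: odd_strip_count; vm_compute. Qed.

(** * Solutions of a x + b y = n *)

(** This is [G (x, y)]; for positive [x] and [y] the bounds [a, b <= n] exclude no solution. *)
Definition pairs_count (n x y : nat) : nat :=
  \sum_(a < n.+1) \sum_(b < n.+1) [&& 0 < a, 0 < b & a * x + b * y == n].

Lemma pairs_countC n x y : pairs_count n x y = pairs_count n y x.
Proof.
rewrite /pairs_count exchange_big; apply: eq_bigr => a _; apply: eq_bigr => b _.
by rewrite addnC; case: (0 < a); case: (0 < b).
Qed.

(** The equation determines [b]. The bound [lo] is 0 for positive solutions, and equals the other
    unknown when solutions are sorted by which unknown is larger. *)
Lemma sum_solve n r c lo : 0 < r ->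
  \sum_(b < n.+1) ((lo < b) && (c + b * r == n) : nat)
  = (c + lo * r < n) && (r %| n - c).
Proof.
move=> r0.
have E (b : nat) : (lo < b) && (c + b * r == n) =
   (b == (n - c) %/ r) && ((c + lo * r < n) && (r %| n - c)).
  apply/andP/andP => [[h /eqP E]|[/eqP-> /andP[h1 h2]]].
    have -> : n - c = b * r by lia.
    rewrite mulnK // eqxx dvdn_mull // andbT; split=> //.
    by rewrite -E ltn_add2l ltn_pmul2r.
  rewrite divnK //; split; last lia.
  by rewrite -(ltn_pmul2r r0) divnK //; lia.
under eq_bigr do rewrite E.
case: (_ && _) => /=; last by rewrite big1 // => b _; rewrite andbF.
under eq_bigr do rewrite andbT.
rewrite sum_eq_ord; have := leq_div (n - c) r; lia.
Qed.

Lemma sum_dvdn n s : 0 < n ->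
  \sum_(m < n.+1) (m * s == n : nat) = (s %| n).
Proof.
case: (posnP s) => [-> n0|s0 n0].
  by rewrite dvd0n big1 => [|m _]; rewrite ?muln0; lia.
have := sum_solve n 0 0 s0; rewrite mul0n add0n n0 subn0 /= => <-.
by apply: eq_bigr => m _; case: (posnP m) => [->|m0]; rewrite ?mul0n /=; lia.
Qed.

Lemma pairs_count1 n x y : 0 < x ->
  pairs_count n x y = \sum_(b < n.+1) [&& 0 < b, b * y < n & x %| n - b * y].
Proof.
move=> x0; rewrite pairs_countC; apply: eq_bigr => b _.
have := sum_solve n (b * y) 0 x0; rewrite mul0n addn0.
case: (posnP b) => [->|b0] /= E; first by rewrite big1.
by rewrite -E.
Qed.

Lemma pairs_count_out n x y : n < y -> pairs_count n x y = 0.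
Proof.
move=> h; rewrite /pairs_count big1 // => a _; rewrite big1 // => b _.
by apply/eqP; rewrite eqb0; apply/negP => /and3P[a0 b0 /eqP E]; nia.
Qed.

(* A pair [(a, b)] with [a d + b r = n] either has [a < b] and comes from the
   solution [(b - a) r + a (r + d) = n], or has [a = b], or has [a > b] and comes
   from the solution [(a - b) d + b (r + d) = n]. *)
Lemma pairs_count_split n d r : 0 < n -> 0 < d -> 0 < r ->
  pairs_count n d r =
  pairs_count n r (r + d) + (r + d %| n) + pairs_count n d (r + d).
Proof.
move=> n0 d0 r0.
have -> : pairs_count n r (r + d) =
    \sum_(a < n.+1) \sum_(b < n.+1) [&& 0 < a, a < b & a * d + b * r == n].
  rewrite pairs_count1 //; apply: eq_bigr => a _.
  have := sum_solve n (a * d) a r0.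
  case: (posnP a) => [->|a0] /= E; first by rewrite big1.
  rewrite E; congr nat_of_bool.
  have -> : a * d + a * r = a * (r + d) by lia.
  case: ltnP => //= h; have -> : n - a * d = n - a * (r + d) + a * r by lia.
  by rewrite dvdn_addl // dvdn_mull.
have -> : pairs_count n d (r + d) =
    \sum_(a < n.+1) \sum_(b < n.+1) [&& 0 < b, b < a & a * d + b * r == n].
  rewrite pairs_count1 // exchange_big; apply: eq_bigr => b _.
  have := sum_solve n (b * r) b d0.
  under eq_bigr => a _ do rewrite addnC.
  case: (posnP b) => [->|b0] /= E; first by rewrite big1.
  rewrite E; congr nat_of_bool.
  have -> : b * r + b * d = b * (r + d) by lia.
  case: ltnP => //= h; have -> : n - b * r = n - b * (r + d) + b * d by lia.
  by rewrite dvdn_addl // dvdn_mull.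
rewrite -sum_dvdn // -!big_split /=; apply: eq_bigr => a _.
have -> : (a * (r + d) == n : nat) =
   \sum_(b < n.+1) ((b == a :> nat) && (a * (r + d) == n) : nat).
  case: (_ == n); last by rewrite big1 // => b _; rewrite andbF.
  under eq_bigr do rewrite andbT.
  by rewrite sum_eq_ord ltn_ord.
rewrite -!big_split /=; apply: eq_bigr => b _.
have -> : (b == a :> nat) && (a * (r + d) == n) =
          [&& 0 < a, 0 < b, b == a :> nat & a * d + b * r == n].
  case: eqP => [->|_]; last by rewrite !andbF.
  by rewrite mulnDr [a * r + _]addnC; case: (posnP a) => [->|] //=; lia.
by case: (_ == n); rewrite ?andbF ?andbT //; lia.
Qed.

(** * Telescoping at a fixed gap *)

Lemma sum_telescope N d (h : nat -> nat) :
  \sum_(r < N) h r + \sum_(e < d) h (N + e) = \sum_(e < d) h e + \sum_(r < N) h (d + r).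
Proof.
have E a b : \sum_(0 <= i < a + b) h i = \sum_(r < a) h r + \sum_(e < b) h (a + e).
  by rewrite big_mkord big_split_ord.
by rewrite -!E addnC.
Qed.

(** Summing [pairs_count_split] over [r], the terms [G (d, r)] cancel against the shifted
    [G (d, r + d)]. Only the first [d] survive, because [G (d, s)] vanishes for [s > n]. *)
Lemma sum_pairs_count_gap n d : 0 < n -> 0 < d ->
  \sum_(r < n) pairs_count n r.+1 (r.+1 + d) + \sum_(r < n) (r.+1 + d %| n) =
  \sum_(e < d) pairs_count n d e.+1.
Proof.
move=> n0 d0.
have := sum_telescope n d (fun r => pairs_count n d r.+1).
rewrite [X in _ + X = _]big1 => [|e _]; last by rewrite pairs_count_out //; lia.
rewrite addn0.
have -> : \sum_(r < n) pairs_count n d r.+1 =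
   \sum_(r < n) pairs_count n r.+1 (r.+1 + d) + \sum_(r < n) (r.+1 + d %| n)
   + \sum_(r < n) pairs_count n d (d + r).+1.
  rewrite -!big_split /=; apply: eq_bigr => r _.
  by rewrite pairs_count_split //; congr (_ + pairs_count _ _ _); lia.
by lia.
Qed.

Lemma sum_dvdn_gap n d (g : nat -> nat) : 0 < n -> (forall e, n <= e -> n < g e) ->
  \sum_(r < n) (g (d + r) %| n) + \sum_(e < d) (g e %| n) = \sum_(s < n) (g s %| n).
Proof.
move=> n0 hg; have := sum_telescope n d (fun s => g s %| n : nat).
rewrite [X in _ + X = _]big1 => [|e _]; first by lia.
by rewrite gtnNdvd // hg; lia.
Qed.

(** * Counting hooks and hook-strip pairs by size *)

Lemma card_set_sum (T : finType) (P : pred T) : #|[set t | P t]| = \sum_t (P t : nat).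
Proof.
by rewrite -sum1_card [LHS]big_mkcond /=; apply: eq_bigr => t _; rewrite inE; case: (P t).
Qed.

Lemma card_hook_params k n : 0 < n ->
  #|hook_params k n| = \sum_(s < n.+1) (s %| n) * minn k s.
Proof.
move=> n0; rewrite card_set_sum.
rewrite -(pair_bigA _ (fun (ms : 'I_n.+1 * 'I_n.+1) (p : 'I_k.+1) =>
   [&& 0 < p, p <= ms.2 & ms.1 * ms.2 == n] : nat)) /=.
rewrite -(pair_bigA _ (fun (m s : 'I_n.+1) =>
   \sum_(p < k.+1) ([&& 0 < p, p <= s & m * s == n] : nat))) /=.
rewrite exchange_big; apply: eq_bigr => s _ /=.
rewrite -sum_dvdn // big_distrl /=; apply: eq_bigr => m _.
rewrite big_ord_recl /= add0n minnC -sum_ltn big_distrr /=.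
by apply: eq_bigr => p _; rewrite /bump /=; case: (_ == n); rewrite ?andbF ?andbT; lia.
Qed.

(** Each hook size [s >= k] dividing [n] allows [k] row numbers, a multiple of 4. Working modulo 4
    is enough because this count enters doubled modulo 8. *)
Lemma card_hook_params_mod4 k n : 0 < n -> 4 %| k ->
  #|hook_params k n| = \sum_(s < k) (s %| n) * s %[mod 4].
Proof.
move=> n0 k4; rewrite card_hook_params //.
(* With the cutoff [s < k] inside the summand, both sums can be compared on the range [n.+1 + k]. *)
pose F s := (s %| n) * ((s < k) * s).
have -> : \sum_(s < k) (s %| n) * s = \sum_(s < n.+1 + k) F s.
  rewrite addnC big_split_ord /= [X in _ = _ + X]big1 ?addn0 => [|s _].
    by apply: eq_bigr => s _; rewrite /F ltn_ord mul1n.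
  by rewrite /F ltnNge leq_addr muln0.
rewrite big_split_ord /= [X in _ = _ + X %[mod _]]big1 ?addn0 => [|s _]; last first.
  by rewrite /F gtnNdvd // leq_addr.
have -> : \sum_(s < n.+1) (s %| n) * minn k s =
    (\sum_(s < n.+1) (s %| n) * (k <= s)) * k + \sum_(s < n.+1) F s.
  rewrite big_distrl -big_split /=; apply: eq_bigr => s _; rewrite /F /=.
  by case: (s %| n); case: (leqP k s); lia.
by case/dvdnP: k4 => q ->; rewrite mulnA modnMDl.
Qed.

Lemma card_strip_params k n :
  #|strip_params k n| = \sum_(m : 'I_n.+1 * 'I_n.+1) \sum_(s : 'I_n.+1 * 'I_n.+1)
    ((0 < m.2 < m.1) && (m.1 * s.1 + m.2 * s.2 == n)) * strip_count k s.1 s.2.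
Proof.
rewrite card_set_sum.
rewrite -(pair_bigA _ (fun (ms : 'I_n.+1 * 'I_n.+1 * ('I_n.+1 * 'I_n.+1))
    (q : 'I_k.+1 * ('I_k * 'I_k)) =>
   [&& 0 < ms.1.2 < ms.1.1, ms.1.1 * ms.2.1 + ms.1.2 * ms.2.2 == n
     & strip_cond ms.2.1 ms.2.2 q.1 q.2.1 q.2.2] : nat)) /=.
rewrite -(pair_bigA _ (fun (m s : 'I_n.+1 * 'I_n.+1) =>
   \sum_(q : 'I_k.+1 * ('I_k * 'I_k))
   ([&& 0 < m.2 < m.1, m.1 * s.1 + m.2 * s.2 == n
     & strip_cond s.1 s.2 q.1 q.2.1 q.2.2] : nat))) /=.
apply: eq_bigr => m _; apply: eq_bigr => s _.
under eq_bigr do rewrite andbA.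
case: (_ && (_ == n)); last by rewrite big1.
rewrite mul1n /strip_count.
rewrite -(pair_bigA _ (fun (p : 'I_k.+1) (ij : 'I_k * 'I_k) =>
   strip_cond s.1 s.2 p ij.1 ij.2 : nat)) /=.
apply: eq_bigr => p _.
by rewrite -(pair_bigA _ (fun (i j : 'I_k) => strip_cond s.1 s.2 p i j : nat)).
Qed.

(** Modulo 2 this is the number of solutions with distinct multipliers: the diagonal ones, counted
    by [r + s %| n], are added instead of subtracted. *)
Definition pair_weight (n r s : nat) : nat := pairs_count n r s + (r + s %| n).

Lemma pairs_count_neq n r s : 0 < n ->
  pairs_count n r s =
  \sum_(m : 'I_n.+1 * 'I_n.+1) ([&& 0 < m.1, 0 < m.2, m.1 != m.2 :> nat
                                  & m.1 * r + m.2 * s == n] : nat) + (r + s %| n).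
Proof.
move=> n0; rewrite -sum_dvdn // /pairs_count.
rewrite -(pair_bigA _ (fun (a b : 'I_n.+1) =>
   [&& 0 < a, 0 < b, a != b :> nat & a * r + b * s == n] : nat)) /=.
rewrite -big_split /=; apply: eq_bigr => a _.
have -> : (a * (r + s) == n : nat) =
   \sum_(b < n.+1) ((b == a :> nat) && (a * (r + s) == n) : nat).
  case: (_ == n); last by rewrite big1 // => b _; rewrite andbF.
  under eq_bigr do rewrite andbT.
  by rewrite sum_eq_ord ltn_ord.
rewrite -big_split /=; apply: eq_bigr => b _.
case: (b =P a :> nat) => [->|/eqP h] /=.
  by rewrite mulnDr eqxx /=; case: (posnP a) => [->|] //=; lia.
have -> : a != b :> nat by rewrite eq_sym.
by rewrite addn0.
Qed.

Section StripParity.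
Variables (k n : nat).
Hypotheses (n_gt0 : 0 < n)
  (count_odd : forall s1 s2, odd (strip_count k s1 s2) = strip_parity k s1 s2).

Lemma odd_card_strip_params :
  odd #|strip_params k n| =
  odd (\sum_(r < n.+1) \sum_(s < n.+1)
         ((r < s) && strip_parity k r s) * pair_weight n r s).
Proof.
rewrite card_strip_params.
(* The parity is symmetric and vanishes on the diagonal, so it splits into the halves [r < s] and
   [s < r]. *)
pose T (r s : nat) : nat := (r < s) && strip_parity k r s.
have T_sym r s : (strip_parity k r s : nat) = T r s + T s r.
  have C : strip_parity k s r = strip_parity k r s.
    by rewrite /strip_parity minnC maxnC.
  rewrite /T C; case: (ltngtP r s) => //= E; first by rewrite addn0.
  by subst s; rewrite /strip_parity minnn maxnn ltnn andbF.
transitivity (odd (\sum_(m : 'I_n.+1 * 'I_n.+1) \sum_(s : 'I_n.+1 * 'I_n.+1)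
    ((0 < m.2 < m.1) && (m.1 * s.1 + m.2 * s.2 == n)) * (T s.1 s.2 + T s.2 s.1))).
  apply: eq_odd_sum => m _; apply: eq_odd_sum => s _.
  by rewrite -T_sym !oddM count_odd !oddb.
have -> : \sum_(m : 'I_n.+1 * 'I_n.+1) \sum_(s : 'I_n.+1 * 'I_n.+1)
    ((0 < m.2 < m.1) && (m.1 * s.1 + m.2 * s.2 == n)) * (T s.1 s.2 + T s.2 s.1) =
  \sum_(m : 'I_n.+1 * 'I_n.+1) \sum_(s : 'I_n.+1 * 'I_n.+1)
    [&& 0 < m.1, 0 < m.2, m.1 != m.2 :> nat & m.1 * s.1 + m.2 * s.2 == n]
    * T s.1 s.2.
  (* Exchanging values and sizes together turns the half [s < r] with [m1 > m2] into [r < s] with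
     [m1 < m2]; both halves merge into [m1 != m2]. *)
  pose sw (x : 'I_n.+1 * 'I_n.+1) := (x.2, x.1).
  have sw_inj : injective sw by move=> [a b] [c d] [-> ->].
  under eq_bigr do under eq_bigr do rewrite mulnDr.
  under eq_bigr do rewrite big_split /=.
  rewrite big_split /= [X in _ + X](reindex_inj sw_inj) /=.
  under [X in _ + X]eq_bigr do rewrite (reindex_inj sw_inj) /=.
  rewrite -big_split; apply: eq_bigr => m _; rewrite -big_split; apply: eq_bigr => s _ /=.
  rewrite -mulnDl; congr (_ * _); rewrite [m.2 * _ + _]addnC.
  by case: (_ == n); rewrite ?andbF ?andbT //; lia.
rewrite exchange_big /= (pair_bigA _ (fun (r s : 'I_n.+1) =>
         ((r < s) && strip_parity k r s) * pair_weight n r s)) /=.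
apply: eq_odd_sum => s _; rewrite -big_distrl /= mulnC.
rewrite /T !oddM; congr (_ && _).
by rewrite /pair_weight (pairs_count_neq _ _ n_gt0) !oddD addbK.
Qed.

Lemma pair_weight_out r s : n < s -> pair_weight n r s = 0.
Proof.
move=> h; rewrite /pair_weight pairs_count_out // gtnNdvd //; lia.
Qed.

End StripParity.

(** * Reduction to finitely many equations *)

Lemma sum_window N r k (h : nat -> nat) : (forall s, N <= s -> h s = 0) ->
  \sum_(s < N) ((r <= s) && (s - r < k)) * h s = \sum_(d < k) h (r + d).
Proof.
move=> hN.
have E s : ((r <= s) && (s - r < k) : nat) = \sum_(d < k) (s == r + d : nat).
  case: (leqP r s) => hr /=.
    rewrite -sum_eq_ord; apply: eq_bigr => d _.
    by congr nat_of_bool; apply/eqP/eqP; lia.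
  by rewrite big1 // => d _; apply/eqP; rewrite eqb0; apply/eqP; lia.
under eq_bigr do rewrite E big_distrl /=.
rewrite exchange_big; apply: eq_bigr => d _ /=.
transitivity (\sum_(s < N) (s == r + d :> nat) * h (r + d)).
  by apply: eq_bigr => s _; case: eqP => // ->.
rewrite -big_distrl /= sum_eq_ord; case: ltnP => h1; first by rewrite mul1n.
by rewrite hN.
Qed.

Lemma sum_odd K (F : nat -> nat) :
  \sum_(d < K.*2) odd d * F d = \sum_(c < K) F c.*2.+1.
Proof.
elim: K => [|K IH]; first by rewrite !big_ord0.
rewrite doubleS !big_ord_recr /= IH odd_double mul0n addn0 mul1n //.
Qed.

Lemma sum_trunc a b (F : nat -> nat) : a <= b -> (forall i, a <= i -> F i = 0) ->
  \sum_(i < b) F i = \sum_(i < a) F i.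
Proof.
move=> /subnKC <- h; rewrite big_split_ord /= [X in _ + X]big1 ?addn0 // => i _.
by rewrite h // leq_addr.
Qed.

Lemma sum2_trunc a b (F : nat -> nat -> nat) : a <= b ->
  (forall r s, a <= s -> F r s = 0) -> (forall r s, s <= r -> F r s = 0) ->
  \sum_(r < b) \sum_(s < b) F r s = \sum_(r < a) \sum_(s < a) F r s.
Proof.
move=> ab h1 h2.
rewrite (@sum_trunc a b (fun r => \sum_(s < b) F r s) ab) => [|r hr]; last first.
  rewrite big1 // => s _; case: (leqP s r) => h; first exact: h2.
  by apply: h1; lia.
by apply: eq_bigr => r _; apply: (sum_trunc ab) => s; apply: h1.
Qed.

(** The remainder, modulo 2, of the weights of all pairs at distance [c.*2.+1], apart from two
    divisor sums independent of [c]. *)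
Definition gap_part (n c : nat) : nat :=
  \sum_(e < c.*2.+1) (pairs_count n c.*2.+1 e.+1 + (e.+1 %| n))
  + \sum_(t < c.+1) (t.*2.+1 %| n).

Definition small_part (k n : nat) : nat :=
  \sum_(r < k) \sum_(s < k) ((0 < r < s) && small_parity k r s) * pair_weight n r s.

(** With [d = c.*2.+1], the [G] terms telescope, the divisors [r + d] are all those above [d], and
    the divisors [r + (r + d)] are the odd ones above [d]; both divisor sums are replaced by their
    complements. *)
Lemma odd_sum_gap n c : 0 < n ->
  odd (\sum_(r < n) pair_weight n r.+1 (r.+1 + c.*2.+1)) =
  odd (gap_part n c + (\sum_(s < n) (s.+1 %| n) + \sum_(s < n) (s.*2.+1 %| n))).
Proof.
move=> n0; rewrite /pair_weight /gap_part !big_split /=.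
have := @sum_pairs_count_gap n c.*2.+1 n0 isT.
have := @sum_dvdn_gap n c.*2.+1 succn n0 (fun e h => h).
have h e : n <= e -> n < e.*2.+1 by lia.
have := @sum_dvdn_gap n c.+1 (fun t => t.*2.+1) n0 h.
have -> : \sum_(r < n) ((c.+1 + r).*2.+1 %| n) =
          \sum_(r < n) (r.+1 + (r.+1 + c.*2.+1) %| n).
  by apply: eq_bigr => r _; congr (nat_of_bool (_ %| _)); lia.
have -> : \sum_(r < n) ((c.*2.+1 + r).+1 %| n) = \sum_(r < n) (r.+1 + c.*2.+1 %| n).
  by apply: eq_bigr => r _; congr (nat_of_bool (_ %| _)); lia.
rewrite /=; lia.
Qed.

Lemma odd_card_strip_params_finite K n : 0 < n -> ~~ odd K ->
  (forall s1 s2, odd (strip_count K.*2 s1 s2) = strip_parity K.*2 s1 s2) ->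
  odd #|strip_params K.*2 n| =
  odd (\sum_(c < K) gap_part n c + small_part K.*2 n).
Proof.
move=> n0 oK hk; rewrite odd_card_strip_params //; set k := K.*2.
(* Modulo 2 the exclusive or in [strip_parity] becomes a sum. *)
transitivity (odd (
    \sum_(r < n.+1) \sum_(s < n.+1) ((0 < r < s) && near_parity k r s) * pair_weight n r s
  + \sum_(r < n.+1) \sum_(s < n.+1) ((0 < r < s) && small_parity k r s) * pair_weight n r s)).
  rewrite -big_split /=; apply: eq_odd_sum => r _.
  rewrite -big_split /=; apply: eq_odd_sum => s _.
  rewrite -mulnDl !oddM oddD !oddb; congr (_ && _).
  rewrite /strip_parity; case: (boolP (r < s)) => h; last by rewrite !andbF.
  have -> : minn r s = r by lia.
  have -> : maxn r s = s by lia.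
  by rewrite h ?andbT; case: (0 < r).
rewrite !oddD; congr (_ (+) _); last first.
  pose F r s := ((0 < r < s) && small_parity k r s) * pair_weight n r s.
  have F1 r s : s <= r -> F r s = 0 by move=> h; rewrite /F [r < s]ltnNge h andbF.
  have F2 r s : k <= s -> F r s = 0.
    by move=> h; rewrite /F /small_parity [s < k]ltnNge h !andbF.
  have F3 r s : n.+1 <= s -> F r s = 0 by rewrite /F => h; rewrite pair_weight_out // muln0.
  congr odd; rewrite /small_part -/F.
  case: (leqP n.+1 k) => h.
    by rewrite -[RHS]/(\sum_(r < k) \sum_(s < k) F r s) (sum2_trunc h).
  by rewrite -[LHS]/(\sum_(r < n.+1) \sum_(s < n.+1) F r s) (sum2_trunc (ltnW h)).
have -> : \sum_(r < n.+1) \sum_(s < n.+1) ((0 < r < s) && near_parity k r s) * pair_weight n r s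
  = \sum_(c < K) \sum_(r < n) pair_weight n r.+1 (r.+1 + c.*2.+1).
  rewrite big_ord_recl big1 ?add0n //=.
  rewrite -(sum_odd _ (fun d => \sum_(r < n) pair_weight n r.+1 (r.+1 + d))).
  under [RHS]eq_bigr do rewrite big_distrr /=.
  rewrite [RHS]exchange_big /=; apply: eq_bigr => r _.
  rewrite /bump /= add1n.
  pose h s := odd (s - r.+1) * pair_weight n r.+1 s.
  have hN s : n.+1 <= s -> h s = 0 by move=> hs; rewrite /h pair_weight_out // muln0.
  have := sum_window r.+1 k hN; rewrite /h.
  under [X in _ = X -> _]eq_bigr do rewrite addKn.
  move <-; apply: eq_bigr => s _; rewrite mulnA; congr (_ * _).
  rewrite /near_parity mulnb; congr nat_of_bool.
  by case: (ltngtP r.+1 s) => //= [|<-]; rewrite ?subnn // andbC.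
(* The full divisor sums occur once for each [c < K] and cancel because [K] is even. *)
transitivity (odd (\sum_(c < K) (gap_part n c +
   (\sum_(s < n) (s.+1 %| n) + \sum_(s < n) (s.*2.+1 %| n))))).
  by apply: eq_odd_sum => c _; apply: odd_sum_gap.
by rewrite big_split /= oddD sum_nat_const card_ord oddM (negbTE oK) addbF.
Qed.

(** * Periodicity *)

Lemma pl_over_mod8_finite K n : 0 < n -> ~~ odd K ->
  (forall s1 s2, odd (strip_count K.*2 s1 s2) = strip_parity K.*2 s1 s2) ->
  pl_over K.*2 n = 2 * \sum_(s < K.*2) (s %| n) * s
                   + 4 * (\sum_(c < K) gap_part n c + small_part K.*2 n) %[mod 8].
Proof.
move=> n0 oK hk; rewrite pl_over_mod8 // card_with_one_free_cell //.
rewrite card_with_two_free_cells //.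
have k4 : 4 %| K.*2 by lia.
have := card_hook_params_mod4 n0 k4; have := odd_card_strip_params_finite n0 oK hk.
lia.
Qed.

Lemma pairs_count_bound n x y N : 0 < x -> 0 < y -> n <= N ->
  pairs_count n x y = \sum_(b < N) ((b.+1 * y < n) && (x %| n - b.+1 * y)).
Proof.
move=> x0 y0 nN; rewrite pairs_count1 // big_ord_recl add0n /=.
rewrite (@sum_trunc n N (fun b => (b.+1 * y < n) && (x %| n - b.+1 * y) : nat) nN) //.
by move=> b hb; have -> : (b.+1 * y < n) = false by nia.
Qed.

(** Solutions with [b > P / y] become those for [n] after lowering [b] by [P / y]; the first sum
    counts the others. *)
Lemma pairs_count_add n x y P : 0 < n -> 0 < x -> 0 < y -> x %| P -> y %| P ->
  pairs_count (n + P) x y =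
  \sum_(b < P %/ y) (x %| n + P - b.+1 * y) + pairs_count n x y.
Proof.
move=> n0 x0 y0 xP yP; have PE := divnK yP; set J := P %/ y in PE *.
rewrite (@pairs_count_bound (n + P) x y (J + (n + P))) //; last lia.
rewrite (@pairs_count_bound n x y (n + P)) //; last lia.
rewrite big_split_ord /=; congr (_ + _); apply: eq_bigr => b _.
  have hb := ltn_ord b.
  by have -> : b.+1 * y < n + P by nia.
have -> : (J + b).+1 * y = b.+1 * y + P by nia.
by rewrite ltn_add2r subnDr.
Qed.

(** Two successive additions of [P] add the same number of solutions, so the parity returns after
    [P.*2]. *)
Lemma odd_pairs_count_period n x y P : 0 < n -> 0 < x -> 0 < y -> x %| P -> y %| P ->
  odd (pairs_count (n + P.*2) x y) = odd (pairs_count n x y).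
Proof.
move=> n0 x0 y0 xP yP; rewrite -addnn addnA !pairs_count_add //; last lia.
have -> : \sum_(b < P %/ y) (x %| n + P + P - b.+1 * y) =
          \sum_(b < P %/ y) (x %| n + P - b.+1 * y).
  apply: eq_bigr => b _; congr nat_of_bool.
  have hb : b.+1 * y <= P by rewrite -[X in _ <= X](divnK yP) leq_mul2r ltn_ord orbT.
  have -> : n + P + P - b.+1 * y = (n + P - b.+1 * y) + P by lia.
  by rewrite dvdn_addl.
by rewrite addnA addnn oddD odd_double.
Qed.

(** The sums [r + s] may reach beyond [k] and occur only in divisibility tests, so they are asked to
    divide [P.*2] rather than [P]. *)
Definition period_ok (k P : nat) : bool :=
  all (fun x => x.+1 %| P) (iota 0 k.-1) &&
  all (fun r => all (fun s => ((0 < r < s) && small_parity k r s) ==> (r + s %| P.*2))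
     (iota 0 k)) (iota 0 k).

Section Period.
Variables (K n P : nat).
Hypotheses (n_gt0 : 0 < n) (P_ok : period_ok K.*2 P).

Let dvdP x : 0 < x -> x < K.*2 -> x %| P.
Proof.
case: x => // x _ h; case/andP: P_ok => /allP/(_ x) + _; rewrite mem_iota; apply.
lia.
Qed.

Let dvd_period x : 0 < x -> x < K.*2 -> (x %| n + P.*2) = (x %| n).
Proof.
by move=> h1 h2; rewrite dvdn_addl // -addnn dvdn_addl ?dvdP.
Qed.

Lemma odd_gap_part_period c : c < K -> odd (gap_part (n + P.*2) c) = odd (gap_part n c).
Proof.
move=> hc; rewrite /gap_part !oddD; congr (_ (+) _).
  apply: eq_odd_sum => e _; have := ltn_ord e => he.
  rewrite !oddD dvd_period //; last lia.
  by rewrite odd_pairs_count_period // dvdP //; lia.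
apply: eq_odd_sum => t _; have := ltn_ord t => ht.
by rewrite dvd_period //; lia.
Qed.

Lemma odd_small_part_period :
  odd (small_part K.*2 (n + P.*2)) = odd (small_part K.*2 n).
Proof.
apply: eq_odd_sum => r _; apply: eq_odd_sum => s _; rewrite !oddM !oddb.
have hr := ltn_ord r; have hs := ltn_ord s.
case E : (_ && small_parity _ _ _) => //=.
have /andP[_ /allP/(_ r)] := P_ok; rewrite mem_iota => /(_ hr)/allP/(_ s).
rewrite mem_iota => /(_ hs)/implyP/(_ E) dv.
case/andP: E => hrs _; rewrite /pair_weight !oddD dvdn_addl //.
by rewrite odd_pairs_count_period // ?dvdP //; lia.
Qed.

Lemma pl_over_period : ~~ odd K ->
  (forall s1 s2, odd (strip_count K.*2 s1 s2) = strip_parity K.*2 s1 s2) ->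
  pl_over K.*2 (n + P.*2) = pl_over K.*2 n %[mod 8].
Proof.
move=> oK hk; rewrite !pl_over_mod8_finite //; last lia.
have -> : \sum_(s < K.*2) (s %| n + P.*2) * s = \sum_(s < K.*2) (s %| n) * s.
  apply: eq_bigr => s _; case: (posnP s) => [->|s0]; first by rewrite !muln0.
  by rewrite dvd_period.
have := odd_small_part_period.
have : odd (\sum_(c < K) gap_part (n + P.*2) c) = odd (\sum_(c < K) gap_part n c).
  by apply: eq_odd_sum => c _; apply: odd_gap_part_period.
lia.
Qed.

End Period.

(** * Evaluation on residues *)

Fixpoint pairs_count_from (fuel x y m : nat) : nat :=
  if fuel is fuel'.+1 then
    if y < m then (x %| m - y) + pairs_count_from fuel' x y (m - y) else 0
  else 0.

(** The running remainder [m] takes the values [n], [n - y], [n - 2 y] and so on; [n] steps suffice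
    since [y > 0]. *)
Lemma pairs_count_fromE n x y : 0 < x -> 0 < y ->
  pairs_count n x y = pairs_count_from n x y n.
Proof.
move=> x0 y0; rewrite (pairs_count_bound x0 y0 (leqnn n)).
suff E f m : \sum_(b < f) ((b.+1 * y < m) && (x %| m - b.+1 * y) : nat) =
             pairs_count_from f x y m by exact: E.
elim: f m => [|f IH] m; first by rewrite big_ord0.
rewrite big_ord_recl /= mul1n; case: (ltnP y m) => h.
  rewrite -IH /=; congr (_ + _); apply: eq_bigr => b _.
  by rewrite /bump /= add1n mulSn subnDA ltn_subRL.
rewrite big1 // => b _; rewrite /bump /= add1n.
by have -> : (b.+2 * y < m) = false by nia.
Qed.

(** Executable right-hand side of [pl_over_mod8_finite]. The arguments of the first count are
    swapped so that subtraction proceeds by the larger number. *)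
Definition pl_over_residue (K n : nat) : nat :=
  let k := K.*2 in
  let w r s := pairs_count_from n r s n + (r + s %| n) in
  (2 * sumn [seq (s %| n) * s | s <- iota 0 k]
   + 4 * (sumn [seq sumn [seq pairs_count_from n e.+1 c.*2.+1 n + (e.+1 %| n)
                           | e <- iota 0 c.*2.+1]
                    + sumn [seq (t.*2.+1 %| n : nat) | t <- iota 0 c.+1]
               | c <- iota 0 K]
          + sumn [seq sumn [seq (if (0 < r < s) && small_parity k r s then w r s else 0)
                           | s <- iota 0 k] | r <- iota 0 k])) %% 8.

Lemma pl_over_residueE K n : 0 < n -> ~~ odd K ->
  (forall s1 s2, odd (strip_count K.*2 s1 s2) = strip_parity K.*2 s1 s2) ->
  pl_over K.*2 n %% 8 = pl_over_residue K n.
Proof.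
move=> n0 oK hk; rewrite pl_over_mod8_finite // /pl_over_residue.
rewrite (sum_iota _ (fun s => (s %| n) * s)) (sum_iota _ (gap_part n)).
congr ((_ + 4 * (sumn _ + _)) %% _).
  apply: eq_map => c; rewrite /gap_part.
  rewrite (sum_iota _ (fun e => pairs_count n c.*2.+1 e.+1 + (e.+1 %| n))).
  rewrite (sum_iota _ (fun t => t.*2.+1 %| n : nat)).
  congr (sumn _ + _); apply: eq_map => e.
  by rewrite pairs_countC pairs_count_fromE.
rewrite /small_part (sum_iota _ (fun r => \sum_(s < K.*2)
  ((0 < r < s) && small_parity K.*2 r s) * pair_weight n r s)).
congr sumn; apply: eq_map => r.
rewrite (sum_iota _ (fun s =>
  ((0 < r < s) && small_parity K.*2 r s) * pair_weight n r s)).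
congr sumn; apply: eq_map => s.
case: ifP => [/andP[h _]|_]; last by rewrite mul0n.
by rewrite mul1n /pair_weight pairs_count_fromE //; lia.
Qed.

Lemma pl_over_mod8_eq0 K P m0 n q :
  0 < m0 -> ~~ odd K -> period_ok K.*2 P ->
  (forall s1 s2, odd (strip_count K.*2 s1 s2) = strip_parity K.*2 s1 s2) ->
  n = m0 + q * P.*2 -> pl_over_residue K m0 = 0 ->
  pl_over K.*2 n = 0 %[mod 8].
Proof.
move=> m00 oK Pok hk -> h.
elim: q => [|q IH]; first by rewrite mul0n addn0 pl_over_residueE // h.
by rewrite mulSn [P.*2 + _]addnC addnA pl_over_period //; lia.
Qed.

Lemma pl_over4_eq0 m0 n q : 0 < m0 -> n = m0 + q * 24 ->
  pl_over_residue 2 m0 = 0 -> pl_over 4 n = 0 %[mod 8].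
Proof.
move=> h1 h2 h3; have P_ok : period_ok 2.*2 12 by vm_compute.
exact: (@pl_over_mod8_eq0 2 12 m0 n q h1 isT P_ok odd_strip_count4 h2 h3).
Qed.

Lemma pl_over8_eq0 m0 n q : 0 < m0 -> n = m0 + q * 840 ->
  pl_over_residue 4 m0 = 0 -> pl_over 8 n = 0 %[mod 8].
Proof.
(* 420 is the least common multiple of 1 to 7. *)
move=> h1 h2 h3; have P_ok : period_ok 4.*2 420 by vm_compute.
exact: (@pl_over_mod8_eq0 4 420 m0 n q h1 isT P_ok odd_strip_count8 h2 h3).
Qed.

(** As 840 is four times 210, four values of [n] represent all residues; [n.-1 %% 4] followed by a
    successor keeps the representative positive. *)
Lemma pl_over8_progression_eq0 c n : 0 < n ->
  all (fun r => pl_over_residue 4 (210 * r.+1 + c) == 0) (iota 0 4) ->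
  pl_over 8 (210 * n + c) = 0 %[mod 8].
Proof.
move=> n0 /allP h; have hr : n.-1 %% 4 < 4 by rewrite ltn_mod.
apply: (@pl_over8_eq0 (210 * (n.-1 %% 4).+1 + c) _ (n.-1 %/ 4)).
- lia.
- lia.
- by apply/eqP; apply: h; rewrite mem_iota.
Qed.

Theorem theorem1p8 (n : nat) (hn : 1 <= n) :
  (pl_over 4 (12 * n) = 0 %[mod 8]
   /\ pl_over 4 (6 * n + 3) = 0 %[mod 8]) /\
  [/\ pl_over 8 (210 * n) = 0 %[mod 8],
      pl_over 8 (210 * n + 3) = 0 %[mod 8],
      pl_over 8 (210 * n + 9) = 0 %[mod 8]
    & pl_over 8 (210 * n + 105) = 0 %[mod 8]].
Proof.
split; split.
(* Two consecutive multiples of 12 exhaust the period 24. *)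
- have /allP h : all (fun r => pl_over_residue 2 (12 * r.+1) == 0) (iota 0 2).
    by vm_compute.
  have hr : n.-1 %% 2 < 2 by rewrite ltn_mod.
  apply: (@pl_over4_eq0 (12 * (n.-1 %% 2).+1) _ (n.-1 %/ 2)); [lia|lia|].
  by apply/eqP; apply: h; rewrite mem_iota.
(* Four consecutive terms of step 6 exhaust the period 24. *)
- have /allP h : all (fun r => pl_over_residue 2 (6 * r.+1 + 3) == 0) (iota 0 4).
    by vm_compute.
  have hr : n.-1 %% 4 < 4 by rewrite ltn_mod.
  apply: (@pl_over4_eq0 (6 * (n.-1 %% 4).+1 + 3) _ (n.-1 %/ 4)); [lia|lia|].
  by apply/eqP; apply: h; rewrite mem_iota.
- by rewrite -[210 * n]addn0; apply: pl_over8_progression_eq0 hn _; vm_compute.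
- by apply: pl_over8_progression_eq0 hn _; vm_compute.
- by apply: pl_over8_progression_eq0 hn _; vm_compute.
- by apply: pl_over8_progression_eq0 hn _; vm_compute.
Qed.
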